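(* Let $P,\psi_0,\dot\psi_0,u_0,\dot u_0$ be toric Cauchy data as in the context, and let $$\psi(s,x)=(u_0+s\dot u_0)^\star(x)=\sup_{y\in P}\big(\langle x,y\rangle-u_0(y)-s\dot u_0(y)\big),\qquad (s,x)\in\mathbb R_+\times\mathbb R^n .$$ Then: (i) $\psi$ solves the homogeneous real Monge-Ampère equation on its regular locus, i.e. $\mathrm{MA}\,\psi=0$ on $\Delta(\psi)$. In addition, $[0,T^{\mathrm{cvx}}_{\mathrm{span}})\times\mathbb R^n\subset\Delta(\psi)$. (ii) Whenever $T>T^{\mathrm{cvx}}_{\mathrm{span}}$, $\psi$ fails to solve the Cauchy problem $$\mathrm{MA}\,\psi=0\ \text{on }[0,T]\times\mathbb R^n,\qquad \psi(0,\cdot)=\psi_0,\qquad \tfrac{\partial\psi}{\partial s}(0,\cdot)=\dot\psi_0\ \text{on }\mathbb R^n .$$ In particular, the Monge-Ampère measure of $\psi$ charges the set $\Sigma_{\mathrm{sing}}(T)$ with positive mass, and $$\int_{[0,T]\times\mathbb R^n}\mathrm{MA}\,\psi=\int_{\Sigma_{\mathrm{sing}}(T)}\mathrm{MA}\,\psi>0 .$$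
   Context: Toric Cauchy data. $(M,\omega)$ is a toric Kähler manifold of complex dimension $n$, with Delzant moment polytope $P=\{y\in\mathbb R^n: l_k(y)\ge 0,\ k=1,\dots,d\}$, where $l_k(y)=\langle y,v_k\rangle-\lambda_k$ are the affine functions defining the facets (inward primitive normals $v_k$; exactly $n$ facets meet at each vertex and their normals form a lattice basis). $\psi_0:\mathbb R^n\to\mathbb R$ is the open-orbit Kähler potential, in logarithmic coordinates, of an $(S^1)^n$-invariant Kähler metric in the class of $\omega$: it is smooth with positive definite Hessian, and $\nabla\psi_0$ is a diffeomorphism of $\mathbb R^n$ onto the interior $P\setminus\partial P$. $\dot\psi_0$ is the restriction to the open orbit of a smooth $(S^1)^n$-invariant function on $M$. Set $u_0:=\psi_0^\star$ (Legendre-Fenchel dual, a function on $P$) and $\dot u_0:=-\dot\psi_0\circ(\nabla\psi_0)^{-1}$, which extends to an element of $C^\infty(P)$ (smooth up to the boundary). By Guillemin, $u_0=\sum_{k=1}^d l_k\log l_k+F$ with $F\in C^\infty(P)$ (up to the normalization of the $l_k$), and $u_0$ is smooth with positive definite Hessian on the interior of $P$ and on the relative interior of each face. Write $u_s:=u_0+s\dot u_0$ on $P$, $s\in\mathbb R_+=[0,\infty)$. Convex lifespan: $T^{\mathrm{cvx}}_{\mathrm{span}}:=\sup\{s:\ \psi_0^\star-s\,\dot\psi_0\circ(\nabla\psi_0)^{-1}\text{ is convex on }\operatorname{Im}\nabla\psi_0\}\in(0,\infty]$. Regular and singular loci: $\Delta(\psi)\subset\mathbb R_+\times\mathbb R^n$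 is the set of points where $\psi$ is finite and differentiable; $\Sigma_{\mathrm{sing}}:=(\mathbb R_+\times\mathbb R^n)\setminus\Delta(\psi)$ and $\Sigma_{\mathrm{sing}}(T):=\Sigma_{\mathrm{sing}}\cap([0,T]\times\mathbb R^n)$. Monge-Ampère measure: for a convex function $f$, $\mathrm{MA}\,f$ is the Borel measure $(\mathrm{MA}\,f)(E)=$ Lebesgue measure of $\partial f(E)=\bigcup_{p\in E}\partial f(p)$, where $\partial f$ is the subdifferential; it equals $\det\nabla^2 f\,dx^1\wedge\cdots\wedge dx^{n+1}$ for $f\in C^2$. The formula for $\psi$ defines a finite convex function of $(s,x)\in\mathbb R\times\mathbb R^n$, and differentiability and subgradients of $\psi$ at points $(0,x)$ are understood for this function. *)

(* Defs.v *)
From HB Require Import structures.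
From mathcomp Require Import all_boot all_order all_algebra.
From mathcomp Require Import all_classical all_reals all_analysis.

Set Implicit Arguments.
Unset Strict Implicit.
Unset Printing Implicit Defensive.

Import Order.TTheory GRing.Theory Num.Theory.
Import numFieldNormedType.Exports.

Local Open Scope classical_set_scope.
Local Open Scope ring_scope.

Definition dot (R : realType) (m : nat) (x y : 'rV[R]_m) : R :=
  \sum_(i < m) x ord0 i * y ord0 i.

Definition grad (R : realType) (m : nat) (f : 'rV[R]_m -> R)
    (x : 'rV[R]_m) : 'rV[R]_m :=
  \row_(i < m) 'D_(delta_mx ord0 i) f x.

Definition hessian (R : realType) (m : nat) (f : 'rV[R]_m -> R)
    (x : 'rV[R]_m) : 'M[R]_m :=
  \matrix_(i < m, j < m)
    'D_(delta_mx ord0 i) ('D_(delta_mx ord0 j) f) x.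

Definition posdefmx (R : realType) (m : nat) (H : 'M[R]_m) : Prop :=
  forall w : 'rV[R]_m, w != 0 -> 0 < (w *m H *m w^T) ord0 ord0.

(* Meaningful for U open. A map is C^(k+1) on U iff it is (Frechet)
   differentiable on U and its directional derivatives are C^k on U. *)
Fixpoint Ck_on (R : realType) (V W : normedModType R) (k : nat)
    (U : set V) (f : V -> W) : Prop :=
  match k with
  | 0%N => forall x, U x -> {for x, continuous f}
  | k'.+1 => (forall x, U x -> differentiable f x) /\
             (forall w : V, Ck_on k' U ('D_w f))
  end.

Definition smooth_on (R : realType) (V W : normedModType R)
    (U : set V) (f : V -> W) : Prop :=
  forall k, Ck_on k U f.

Definition smooth_upto (R : realType) (m : nat) (P : set 'rV[R]_m)
    (f : 'rV[R]_m -> R) : Prop :=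
  exists2 g : 'rV[R]_m -> R, smooth_on setT g & forall y, P y -> f y = g y.

Definition inverse_map (R : realType) (m : nat)
    (f : 'rV[R]_m -> 'rV[R]_m) : 'rV[R]_m -> 'rV[R]_m :=
  'pinv_(fun=> 0) setT f.

Definition diffeo_onto (R : realType) (m : nat)
    (f : 'rV[R]_m -> 'rV[R]_m) (U : set 'rV[R]_m) : Prop :=
  [/\ set_bij setT U f, smooth_on setT f & smooth_on U (inverse_map f)].

(* Legendre-Fenchel dual of a function with effective domain D. *)
Definition legendre (R : realType) (m : nat) (D : set 'rV[R]_m)
    (f : 'rV[R]_m -> R) (x : 'rV[R]_m) : \bar R :=
  ereal_sup [set (dot x y - f y)%:E | y in D].

Section delzant.
Variables (R : realType) (n d : nat).
Variables (nu : 'I_d -> 'rV[int]_n) (lam : 'I_d -> R).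

Definition facet_fun (k : 'I_d) (y : 'rV[R]_n) : R :=
  dot y (map_mx intr (nu k)) - lam k.

Definition polytope : set 'rV[R]_n :=
  [set y | forall k, 0 <= facet_fun k y].

Definition is_vertex (y : 'rV[R]_n) : Prop :=
  polytope y /\
  forall (a b : 'rV[R]_n) (t : R), polytope a -> polytope b ->
    0 < t < 1 -> y = t *: a + (1 - t) *: b -> a = b.

Definition active (y : 'rV[R]_n) : {set 'I_d} :=
  [set k | facet_fun k y == 0].

Definition primitive_vec (w : 'rV[int]_n) : Prop :=
  \big[gcdn/0%N]_(i < n) `|w ord0 i|%N = 1%N.

Definition lattice_basis (A : {set 'I_d}) : Prop :=
  (forall w : 'rV[int]_n, exists c : 'I_d -> int,
      w = \sum_(k in A) c k *: nu k) /\
  (forall c : 'I_d -> int, \sum_(k in A) c k *: nu k = 0 ->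
      forall k, k \in A -> c k = 0).

Record delzant : Prop := Delzant {
  delzant_bounded : bounded_set polytope ;
  delzant_full : (polytope)° !=set0 ;
  (* each facet_fun k cuts out a facet, different k different facets *)
  delzant_facet : forall k, exists2 y, polytope y & active y = [set k]%SET ;
  delzant_primitive : forall k, primitive_vec (nu k) ;
  delzant_vertex : forall y, is_vertex y ->
    #|active y| = n /\ lattice_basis (active y)
}.

Definition dual_potential (psi0 : 'rV[R]_n -> R) (y : 'rV[R]_n) : R :=
  fine (legendre setT psi0 y).

(* psi0 is the open-orbit potential, in logarithmic coordinates, of a smooth
   torus-invariant Kaehler metric with moment polytope P. By the theorem of
   Guillemin, Abreu and Donaldson such potentials are those for which
   - grad psi0 is a diffeomorphism onto the interior of P,
   - psi0^* is finite on P, with Guillemin's boundary behaviour there;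
     c absorbs the normalization of the facet functions (it depends on
     whether log|z| or log|z|^2 is the logarithmic coordinate). Note that
     ln 0 = 0, so that 0 * ln 0 = 0 on the boundary,
   - psi0^* has positive definite Hessian on the interior of P and on the
     relative interior of each face: a face direction at y is a w along which
     the facet functions vanishing at y are constant, and 'D_w ('D_w u) y
     only involves values of u on the face. Smoothness of psi0^* there follows
     from the boundary behaviour. *)
Record kahler_potential (psi0 : 'rV[R]_n -> R) : Prop := KahlerPotential {
  kp_smooth : smooth_on setT psi0 ;
  kp_hess : forall x, posdefmx (hessian psi0 x) ;
  kp_diffeo : diffeo_onto (grad psi0) (polytope)° ;
  kp_guillemin : exists c : R, exists F : 'rV[R]_n -> R,
    [/\ 0 < c, smooth_upto polytope F &
      forall y, polytope y ->
        legendre setT psi0 y =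
        (c * (\sum_(k < d) facet_fun k y * ln (facet_fun k y)) + F y)%:E] ;
  kp_face_hess : forall y w : 'rV[R]_n, polytope y -> w != 0 ->
    (forall k, k \in active y -> dot w (map_mx intr (nu k)) = 0) ->
    0 < 'D_w ('D_w (dual_potential psi0)) y
}.

(* Smooth invariant functions on the manifold are the smooth functions on P
   composed with the moment map, whose restriction to the open orbit is
   grad psi0; du0 is the smooth extension to P of
   - dpsi0 \o (grad psi0)^-1. *)
Record toric_cauchy_data (psi0 dpsi0 du0 : 'rV[R]_n -> R) : Prop :=
  ToricCauchyData {
  tcd_delzant : delzant ;
  tcd_potential : kahler_potential psi0 ;
  tcd_du0_smooth : smooth_upto polytope du0 ;
  tcd_du0 : forall y, (polytope)° y ->
    du0 y = - dpsi0 (inverse_map (grad psi0) y)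
}.

End delzant.

Definition convex_lifespan (R : realType) (n : nat)
    (psi0 dpsi0 : 'rV[R]_n -> R) : \bar R :=
  ereal_sup [set s%:E | s in
    [set s : R | 0 <= s /\
      convex_function (range (grad psi0))
        (fun y => dual_potential psi0 y
                  - s * dpsi0 (inverse_map (grad psi0) y))]].

(* Space-time R x R^n is 'rV_(1 + n), with time as first coordinate. *)
Definition spacetime (R : realType) (n : nat) (s : R) (x : 'rV[R]_n) :
  'rV[R]_(1 + n) := row_mx s%:M x.

Definition time (R : realType) (n : nat) (p : 'rV[R]_(1 + n)) : R :=
  lsubmx p ord0 ord0.

Definition space (R : realType) (n : nat) (p : 'rV[R]_(1 + n)) : 'rV[R]_n :=
  rsubmx p.

(* psi(s, x) = (u0 + s du0)^*(x), for all real s. *)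
Definition legendre_potential (R : realType) (n : nat) (P : set 'rV[R]_n)
    (u0 du0 : 'rV[R]_n -> R) (p : 'rV[R]_(1 + n)) : \bar R :=
  legendre P (fun y => u0 y + time p * du0 y) (space p).

Definition regular_locus (R : realType) (n : nat)
    (psi : 'rV[R]_(1 + n) -> \bar R) : set 'rV[R]_(1 + n) :=
  [set p | [/\ 0 <= time p, psi p \is a fin_num &
               differentiable (fine \o psi) p]].

Definition singular_locus (R : realType) (n : nat)
    (psi : 'rV[R]_(1 + n) -> \bar R) : set 'rV[R]_(1 + n) :=
  [set p | 0 <= time p] `\` regular_locus psi.

Definition slab (R : realType) (n : nat) (T : R) : set 'rV[R]_(1 + n) :=
  [set p | 0 <= time p <= T].

(* Lebesgue (outer) measure on R^m for m > 0, by countable coverings with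
   half-open boxes. *)
Definition box (R : realType) (m : nat) (a b : 'rV[R]_m) : set 'rV[R]_m :=
  [set x | forall i, a ord0 i < x ord0 i <= b ord0 i].

Definition box_volume (R : realType) (m : nat) (a b : 'rV[R]_m) : R :=
  \prod_(i < m) Num.max 0 (b ord0 i - a ord0 i).

Definition lebesgue_rV (R : realType) (m : nat) (A : set 'rV[R]_m) : \bar R :=
  ereal_inf [set (\sum_(0 <= k <oo) (box_volume (ab k).1 (ab k).2)%:E)%E
    | ab in [set ab : nat -> 'rV[R]_m * 'rV[R]_m |
               A `<=` \bigcup_k box (ab k).1 (ab k).2]].

Definition subdifferential (R : realType) (m : nat) (f : 'rV[R]_m -> R)
    (p : 'rV[R]_m) : set 'rV[R]_m :=
  [set q | forall p', f p + dot q (p' - p) <= f p'].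

(* For f convex and E Borel the union is Lebesgue measurable, so that its
   outer measure is its Lebesgue measure. *)
Definition monge_ampere (R : realType) (m : nat) (f : 'rV[R]_m -> R)
    (E : set 'rV[R]_m) : \bar R :=
  lebesgue_rV (\bigcup_(p in E) subdifferential f p).

Definition borel (R : realType) (m : nat) : set (set 'rV[R]_m) :=
  <<s [set A | open A] >>.
Arguments borel {R m}.

Definition monge_ampere_zero_on (R : realType) (m : nat)
    (f : 'rV[R]_m -> R) (S : set 'rV[R]_m) : Prop :=
  forall E, borel E -> E `<=` S -> monge_ampere f E = 0%E.

Definition solves_cauchy (R : realType) (n : nat) (T : R)
    (psi0 dpsi0 : 'rV[R]_n -> R) (f : 'rV[R]_(1 + n) -> R) : Prop :=
  [/\ monge_ampere_zero_on f (slab T),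
      forall x, f (spacetime 0 x) = psi0 x &
      forall x, is_derive (0 : R) (1 : R) (fun s => f (spacetime s x))
                  (dpsi0 x)].

(* Main.v *)
Require Import Defs.
From HB Require Import structures.
From mathcomp Require Import all_boot all_order all_algebra.
From mathcomp Require Import all_classical all_reals all_analysis.
From mathcomp Require Import measurable_realfun ring lra.

Import Order.TTheory GRing.Theory Num.Theory.
Import numFieldNormedType.Exports.

Set Implicit Arguments.
Unset Strict Implicit.
Unset Printing Implicit Defensive.

Local Open Scope classical_set_scope.
Local Open Scope ring_scope.

(* Writing [f = fine \o psi], [f] is the maximum over the compact polytope [P]
   of the affine functions [p |-> <p, Q y> - u0 y] with [Q y = (- du0 y, y)].
   Where [f] is differentiable its only subgradient is some [Q y], so the
   regular locus is mapped into the graph of [- du0], a null set.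

   For [s] below some [s'] with [u0 + s' du0] convex, [u0 + s du0] is a convex
   combination of the latter and of [u0], so two maximizers at a point of time
   [s] would make [u0] affine on a segment of [P], which contradicts the
   positivity of the Hessian of [u0] along faces; and a maximum of affine
   functions is differentiable wherever the maximizer is unique.

   If [u0 + T du0] is not convex, then near some interior point [y0] it exceeds
   its convex hull by a fixed amount [gap]. For [y] near [y0] and [sigma] in
   [[- du0 y, - du0 y + gap / T]], the function [f - <., (sigma, y)>] attains a
   minimum over [[0, T] x R^n] by coercivity. The minimum is a global one: for
   [s < 0] because [sigma >= - du0 y], and for [s > T] by convexity, because
   the infimum over time [0] is at most the infimum over time [T]. So the
   subgradients over the slab fill a neighbourhood, which cannot be covered by
   the graph of [- du0]. *)

(** * The outer Lebesgue measure *)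

Lemma measurable_scaled_indic_itv (R : realType) (c a b : R) :
  measurable_fun setT
    (fun x : R => (c * \1_(`]a, b]%classic) x)%:E : \bar R).
Proof.
by apply/measurable_EFinP; apply: measurable_funM.
Qed.

Lemma integral_indic_itv (R : realType) (c a b : R) : 0 <= c ->
  (\int[lebesgue_measure]_x (c * \1_(`]a, b]%classic) x)%:E
   = (c * Num.max 0 (b - a))%:E)%E.
Proof.
move=> c0; under eq_integral do rewrite EFinM.
rewrite ge0_integralZl//=; last first.
  by apply/measurable_EFinP; exact: measurable_indic.
rewrite integral_indic// setIT EFinM.
have := @lebesgue_measure_itv R `]a, b]; rewrite /= lte_fin => ->.
congr (_ * _)%E; case: ltP => ab.
  by rewrite -EFinB max_r// subr_ge0 ltW.
by rewrite max_l// subr_le0.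
Qed.

(* The weights absorb the coordinates that are already integrated out. *)
Lemma le_box_weight (R : realType) (m : nat) (c : R) (a b : nat -> R)
    (ck : nat -> R) (A B : nat -> nat -> R) :
  0 <= c -> (forall k, 0 <= ck k) ->
  (forall x : nat -> R,
    ((c * \prod_(i < m) \1_(`]a i, b i]%classic) (x i))%:E <=
     \sum_(0 <= k <oo)
        (ck k * \prod_(i < m) \1_(`]A k i, B k i]%classic) (x i))%:E)%E) ->
  ((c * \prod_(i < m) Num.max 0 (b i - a i))%:E <=
    \sum_(0 <= k <oo)
       (ck k * \prod_(i < m) Num.max 0 (B k i - A k i))%:E)%E.
Proof.
elim: m c ck => [|m IH] c ck c0 ck0 H.
  rewrite big_ord0; have := H (fun=> 0); rewrite big_ord0 => /le_trans; apply.
  by apply: lee_nneseries => k _; rewrite ?big_ord0// lee_fin mulr1 ck0.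
(* Points are sequences indexed by [nat], so the induction on the dimension never changes their
   type; [up x t] sets coordinate [m] to [t]. *)
pose up (x : nat -> R) t i := if i == m then t else x i.
have up_lt x t (i : 'I_m) : up x t i = x i.
  by rewrite /up ltn_eqF.
have up_m x t : up x t m = t by rewrite /up eqxx.
rewrite big_ord_recr/= [X in c * X]mulrC mulrA.
under eq_eseriesr do rewrite big_ord_recr/= [X in _ * X]mulrC mulrA.
(* The length of the last side joins the weight. The pointwise premise is [H] integrated over the
   last coordinate, with sum and integral exchanged. *)
apply: IH => [|k|x]; rewrite ?mulr_ge0 ?le_max ?lexx//.
have p0 (a' b' : nat -> R) :
    0 <= \prod_(i < m) (\1_(`]a' i, b' i]%classic) (x i) : R).
  by apply: prodr_ge0.
rewrite mulrAC -integral_indic_itv; last by rewrite mulr_ge0.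
under eq_eseriesr => k _.
  rewrite mulrAC -integral_indic_itv; last by rewrite mulr_ge0.
  over.
rewrite -integral_nneseries//; first last.
- by move=> k t _; rewrite lee_fin !mulr_ge0.
- by move=> k; exact: measurable_scaled_indic_itv.
apply: ge0_le_integral => //.
- by move=> t _; rewrite lee_fin !mulr_ge0.
- exact: measurable_scaled_indic_itv.
- apply: ge0_emeasurable_sum => //.
  + by move=> k t _ _; rewrite lee_fin !mulr_ge0.
  + by move=> k _; exact: measurable_scaled_indic_itv.
- move=> t _; have := H (up x t).
  rewrite big_ord_recr/= up_m mulrA.
  under eq_bigr do rewrite up_lt.
  move=> /le_trans; apply.
  apply: lee_nneseries => k _.
    by rewrite lee_fin mulr_ge0// prodr_ge0.
  rewrite big_ord_recr/= up_m mulrA.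
  by under eq_bigr do rewrite up_lt.
Qed.

(** A covering yields a pointwise inequality between indicator functions, which [le_box_weight]
    integrates one coordinate at a time, with all weights 1. *)
Lemma lebesgue_rV_box_ge (R : realType) (m : nat) (a b : 'rV[R]_m) :
  ((box_volume a b)%:E <= lebesgue_rV (box a b))%E.
Proof.
apply: le_ereal_inf_tmp => _ [ab cov <-].
pose ext (v : 'rV[R]_m) (i : nat) : R :=
  if insub i is Some j then v ord0 j else 0.
have extE v (i : 'I_m) : ext v i = v ord0 i by rewrite /ext valK.
have volE (v w : 'rV[R]_m) :
    box_volume v w = 1 * \prod_(i < m) Num.max 0 (ext w i - ext v i).
  by rewrite mul1r; apply: eq_bigr => i _; rewrite !extE.
rewrite volE; under eq_eseriesr do rewrite volE.
apply: (@le_box_weight R m 1 _ _ (fun=> 1) (fun k => ext (ab k).1)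
  (fun k => ext (ab k).2)) => // x.
have term0 (v w : nat -> R) :
    0 <= 1 * \prod_(i < m) (\1_(`]v i, w i]%classic) (x i) : R).
  by rewrite mul1r prodr_ge0.
(* Outside the box the left side vanishes; inside, one box of the covering already contributes 1. *)
have [xab|nab] := pselect (box a b (\row_i x i)); last first.
  rewrite [leLHS](_ : _ = 0%E).
    by apply: nneseries_ge0 => k _ _; rewrite lee_fin.
  have [i hi] : exists i : 'I_m, ~ (a ord0 i < x i <= b ord0 i).
    by apply/existsNP => h; apply: nab => i; rewrite mxE; exact: h.
  rewrite (bigD1 i)//= indicE memNset ?mul0r ?mulr0//=.
  by rewrite !extE in_itv/=.
have [k _ xk] := cov _ xab.
rewrite (@nneseriesD1 _ _ k)//; last by move=> j _; rewrite lee_fin.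
rewrite [X in (_ <= X + _)%E](_ : _ = 1%E); last first.
  congr (_%:E); rewrite mul1r big1// => i _.
  by rewrite indicE mem_set//= !extE in_itv/=; have := xk i; rewrite mxE.
rewrite [leLHS](_ : _ = 1%E); last first.
  congr (_%:E); rewrite mul1r big1// => i _.
  by rewrite indicE mem_set//= !extE in_itv/=; have := xab i; rewrite mxE.
by rewrite leeDl// nneseries_ge0// => j _ _; rewrite lee_fin.
Qed.

Lemma box_volume_ge0 (R : realType) (m : nat) (a b : 'rV[R]_m) :
  0 <= box_volume a b.
Proof. by apply: prodr_ge0 => i _; rewrite le_max lexx. Qed.

Lemma lebesgue_rV_ge0 (R : realType) (m : nat) (A : set 'rV[R]_m) :
  (0 <= lebesgue_rV A)%E.
Proof.
apply: le_ereal_inf_tmp => _ [ab _ <-].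
by apply: nneseries_ge0 => k _ _; rewrite lee_fin box_volume_ge0.
Qed.

Lemma le_lebesgue_rV (R : realType) (m : nat) (A B : set 'rV[R]_m) :
  A `<=` B -> (lebesgue_rV A <= lebesgue_rV B)%E.
Proof.
move=> AB; apply: ereal_inf_le_tmp => _ [ab cov <-].
by exists ab => //; exact: subset_trans cov.
Qed.

(** Degenerate boxes have volume 0 in positive dimension; for [m = 0] the volume is an empty
    product, hence 1. *)
Lemma lebesgue_rV0 (R : realType) (m : nat) : (0 < m)%N ->
  lebesgue_rV (@set0 'rV[R]_m) = 0%E.
Proof.
move=> m0; apply/eqP; rewrite eq_le lebesgue_rV_ge0 andbT.
apply: ge_ereal_inf; exists 0%E => //; exists (fun=> (0, 0)) => //=.
apply: eseries0 => k _ _; congr (_%:E).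
rewrite /box_volume (bigD1 (Ordinal m0))//= mxE subrr.
by rewrite max_l ?mul0r.
Qed.

Lemma lebesgue_rV_setU_box (R : realType) (m : nat) (A B : set 'rV[R]_m)
    (a b : 'rV[R]_m) : A `<=` B `|` box a b ->
  (lebesgue_rV A <= lebesgue_rV B + (box_volume a b)%:E)%E.
Proof.
move=> AB; rewrite -leeBlDr//.
apply: le_ereal_inf_tmp => _ [ab cov <-].
rewrite leeBlDr//; apply: ge_ereal_inf.
pose ab' k := if k is k'.+1 then ab k' else (a, b).
exists (\sum_(0 <= k <oo) (box_volume (ab' k).1 (ab' k).2)%:E)%E.
  exists ab' => // x /AB [/cov [k _ xk]|xab]; last by exists 0%N.
  by exists k.+1.
have vol0 k : (0 <= (box_volume (ab' k).1 (ab' k).2)%:E)%E.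
  by rewrite lee_fin box_volume_ge0.
rewrite nneseries_recl// -nneseries_addn// addeC leeD//.
by apply: lee_nneseries => // k _; rewrite addn1.
Qed.

Lemma lebesgue_rV_setU_boxes (R : realType) (m : nat) (A B : set 'rV[R]_m)
    (s : seq ('rV[R]_m * 'rV[R]_m)) :
  (forall x, A x -> B x \/ exists2 p, p \in s & box p.1 p.2 x) ->
  (lebesgue_rV A <= lebesgue_rV B + (\sum_(p <- s) box_volume p.1 p.2)%:E)%E.
Proof.
elim: s A => [|p s IH] A AB.
  rewrite big_nil adde0; apply: le_lebesgue_rV => x /AB [//|[p]].
  by rewrite in_nil.
rewrite big_cons EFinD addeCA addeC.
apply: (@le_trans _ _ (lebesgue_rV (A `\` box p.1 p.2) +
                       (box_volume p.1 p.2)%:E)%E).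
  apply: lebesgue_rV_setU_box => x Ax.
  by have [xp|xp] := pselect (box p.1 p.2 x); [right|left].
apply: leeD => //; apply: IH => x [/AB [?|[q]]]; first by left.
rewrite in_cons => /predU1P[->//|qs xq _]; by right; exists q.
Qed.

(** * Null sets and graphs of continuous functions *)

(** Finite families of boxes are enough for graphs over compact sets, and can be put in front of a
    covering one box at a time. *)
Definition box_null (R : realType) (m : nat) (N : set 'rV[R]_m) : Prop :=
  forall e : R, 0 < e -> exists2 s : seq ('rV[R]_m * 'rV[R]_m),
    \sum_(p <- s) box_volume p.1 p.2 <= e &
    forall x, N x -> exists2 p, p \in s & box p.1 p.2 x.

Lemma lebesgue_rV_setU_null (R : realType) (m : nat) (A B N : set 'rV[R]_m) :
  box_null N -> A `<=` B `|` N -> (lebesgue_rV A <= lebesgue_rV B)%E.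
Proof.
move=> N0 AB; apply/lee_addgt0Pr => e e0.
have [s se sN] := N0 e e0.
apply: (@le_trans _ _ (lebesgue_rV B +
                       (\sum_(p <- s) box_volume p.1 p.2)%:E)%E).
  by apply: lebesgue_rV_setU_boxes => x /AB [?|/sN]; [left|right].
by apply: leeD => //; rewrite lee_fin.
Qed.

Lemma lebesgue_rV_null (R : realType) (m : nat) (A N : set 'rV[R]_m) :
  (0 < m)%N -> box_null N -> A `<=` N -> lebesgue_rV A = 0%E.
Proof.
move=> m0 N0 AN; apply/eqP; rewrite eq_le lebesgue_rV_ge0 andbT.
rewrite -(@lebesgue_rV0 R m)//; apply: (lebesgue_rV_setU_null N0).
by rewrite set0U.
Qed.

Lemma normr_rV_ge (R : realType) (m : nat) (x : 'rV[R]_m) (i : 'I_m) :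
  `|x ord0 i| <= `|x|.
Proof.
rewrite [leRHS]/Num.norm/= mx_normrE.
by apply/bigmax_geP; right; exists (ord0, i).
Qed.

Lemma normr_rV_lt (R : realType) (m : nat) (x : 'rV[R]_m) (e : R) : 0 < e ->
  (forall i, `|x ord0 i| < e) -> `|x| < e.
Proof.
move=> e0 xe; rewrite [ltLHS]/Num.norm/= mx_normrE.
apply/bigmax_ltP; split => // -[i j] _.
by rewrite /= [i]ord1.
Qed.

Lemma compact_unif_cont (R : realType) (V : normedModType R) (P : set V)
    (f : V -> R) (e : R) : compact P -> continuous f -> 0 < e ->
  exists2 d : R, 0 < d &
    forall y z, P y -> P z -> `|y - z| < d -> `|f y - f z| < e.
Proof.
move=> cP cf e0.
have := (@compact_near_coveringP _ P).1 cP.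
move=> /(_ R (0^'+) (fun d y => forall z, `|y - z| < d -> `|f y - f z| < e)).
have H : forall x, P x -> \forall y \near x & d \near (0 : R)^'+,
    forall z, `|y - z| < d -> `|f y - f z| < e.
  move=> x _.
  have e20 : 0 < e / 2 by rewrite divr_gt0.
  have /cvgrPdist_lt /(_ _ e20) /nbhs_normP[r /= r0 xr] := cf x.
  have r20 : 0 < r / 2 by rewrite divr_gt0.
  exists ([set y | `|x - y| < r / 2], [set d : R | d < r / 2]) => /=.
    split; first by apply/nbhs_normP; exists (r / 2).
    exact: nbhs_right_lt.
  move=> [y d] /= [xy dr] z yz.
  have h1 : `|f x - f y| < e / 2 by apply: xr => /=; lra.
  have h2 : `|f x - f z| < e / 2.
    apply: xr => /=.
    rewrite -(subrK y x) -addrA (le_lt_trans (ler_normD _ _))//.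
    by lra.
  rewrite (_ : f y - f z = (f x - f z) - (f x - f y)); last by ring.
  by rewrite (le_lt_trans (ler_normB _ _))//; lra.
move=> /(_ _ H) K.
have [d /= [d0 dP]] := filter_ex (filterI (nbhs_right_gt 0) K).
by exists d => // y z Py Pz yz; exact: dP yz.
Qed.

(** A cube around [P] is cut into cells of side [h], smaller than the modulus of uniform continuity
    for [t]. Over each cell the graph lies in a box of height [2 * t], and the total volume is at
    most [2 * t * K = e]. *)
Lemma graph_box_null (R : realType) (n : nat) (P : set 'rV[R]_n)
    (f : 'rV[R]_n -> R) : compact P -> continuous f ->
  box_null [set (row_mx (f y)%:M y : 'rV[R]_(1 + n)) | y in P].
Proof.
move=> cP cf e e0.
have [M M0 PM] : exists2 M : R, 0 < M &
    forall y, P y -> forall i, `|y ord0 i| <= M.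
  have /compact_bounded [B [_ Bb]] := cP.
  exists (`|B| + 1) => [|y Py i]; first by rewrite ltr_wpDl.
  apply: le_trans (normr_rV_ge _ _) _; apply: Bb => //.
  by rewrite ltr_pwDr// ler_norm.
(* [K] bounds the total volume [(N.+1 * 2 * h) ^+ n] of the boxes' bases. *)
pose K := (8 * M) ^+ n.
have K0 : 0 < K by rewrite exprn_gt0// mulr_gt0.
pose t := e / (2 * K).
have t0 : 0 < t by rewrite divr_gt0// mulr_gt0.
have [d d0 dP] := compact_unif_cont cP cf t0.
pose N := (Num.truncn (2 * M / d)).+1.
pose h := 2 * M / N%:R.
have N0 : 0 < N%:R :> R by rewrite ltr0n.
have h0 : 0 < h by rewrite divr_gt0// mulr_gt0.
have hd : h < d.
  rewrite ltr_pdivrMr// [ltRHS]mulrC -ltr_pdivrMr//.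
  exact: truncnS_gt.
(* Indices run up to [N] inclusive, since a coordinate equal to [M] falls in the cell of index
   [N]. *)
pose cell (k : {ffun 'I_n -> 'I_N.+1}) (y : 'rV[R]_n) :=
  forall i, h * (k i)%:R <= y ord0 i + M < h * (k i).+1%:R.
(* If the cell misses [P], [rep k] is a default value; its box still enters the volume count. *)
pose rep k := get (P `&` cell k).
(* Cells contain their lower faces and boxes do not, so the base of a box starts one step [h] below
   its cell. *)
pose bx k : 'rV[R]_(1 + n) * 'rV[R]_(1 + n) :=
  (row_mx (f (rep k) - t)%:M (\row_i (h * (k i)%:R - h - M)),
   row_mx (f (rep k) + t)%:M (\row_i (h * (k i)%:R + h - M))).
exists [seq bx k | k : {ffun 'I_n -> 'I_N.+1}]; last first.
  move=> _ [y Py <-].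
  have yM i : 0 <= y ord0 i + M <= 2 * M.
    by have := PM y Py i; rewrite ler_norml => /andP[? ?]; lra.
  have kP i : (Num.truncn ((y ord0 i + M) / h) < N.+1)%N.
    rewrite ltnS -(ler_nat R); apply: (@le_trans _ _ ((y ord0 i + M) / h)).
      by rewrite truncn_le// divr_ge0// ?(ltW h0)//; have /andP[] := yM i.
    rewrite ler_pdivrMr// /h mulrCA divff ?gt_eqF// mulr1.
    by have /andP[] := yM i.
  pose k := [ffun i => Ordinal (kP i)].
  have cky : cell k y.
    move=> i; rewrite ffunE/=; have /andP[y0 _] := yM i.
    have q0 : 0 <= (y ord0 i + M) / h by rewrite divr_ge0// ltW.
    rewrite ![h * _]mulrC -ler_pdivlMr// -ltr_pdivrMr//.
    by rewrite truncn_le q0 truncnS_gt.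
  have [Prep crep] : (P `&` cell k) (rep k).
    exact: (getPex (ex_intro _ y (conj Py cky))).
  exists (bx k); first by apply/mapP; exists k => //; rewrite mem_enum.
  have fy : `|f y - f (rep k)| < t.
    apply: dP => //; apply: normr_rV_lt => // i; rewrite !mxE.
    have := cky i; have := crep i; rewrite -(natr1 (k i)) mulrDr mulr1.
    move=> /andP[? ?] /andP[? ?]; rewrite (le_lt_trans _ hd)// ler_norml; lra.
  move=> i; case: (split_ordP i) => j ->; rewrite /= !(row_mxEl, row_mxEr).
    rewrite !ord1 !mxE eqxx !mulr1n.
    by move: fy; rewrite ltr_norml => /andP[? ?]; lra.
  rewrite !mxE; have := cky j; rewrite -(natr1 (k j)) mulrDr mulr1.
  move=> /andP[? ?]; lra.
rewrite big_map big_enum/=.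
have vol k : box_volume (bx k).1 (bx k).2 = 2 * t * (2 * h) ^+ n.
  rewrite /box_volume big_split_ord/= big_ord1 !row_mxEl !mxE eqxx !mulr1n.
  congr (_ * _); first by rewrite max_r; lra.
  rewrite (eq_bigr (fun=> 2 * h)) ?prodr_const ?card_ord// => i _.
  by rewrite !row_mxEr !mxE max_r; lra.
rewrite (eq_bigr (fun=> 2 * t * (2 * h) ^+ n)); last by move=> k _; exact: vol.
rewrite sumr_const card_ffun !card_ord -[_ *+ _]mulr_natr natrX.
rewrite -[leLHS]mulrA -exprMn.
rewrite (_ : e = 2 * t * K); last by rewrite /t; field; rewrite gt_eqF.
rewrite ler_pM2l; last by rewrite mulr_gt0.
rewrite lerXn2r ?nnegrE ?mulr_ge0// ?(ltW h0) ?(ltW M0)//.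
have hN : h * N%:R = 2 * M by rewrite /h divfK// gt_eqF.
(* Hence [2 * h * N.+1 = 4 * M + 2 * h <= 8 * M], the base of the power [K]. *)
have h2 : h <= 2 * M.
  by rewrite -hN ler_peMr ?(ltW h0)// ler1n.
have -> : 2 * h * N.+1%:R = 2 * (h * N%:R) + 2 * h by rewrite -natr1; ring.
by rewrite hN; lra.
Qed.

(** * Maxima of affine functions *)

Lemma dotC (R : realType) (m : nat) (x y : 'rV[R]_m) : dot x y = dot y x.
Proof. by apply: eq_bigr => i _; rewrite mulrC. Qed.

Lemma dotDl (R : realType) (m : nat) (x y z : 'rV[R]_m) :
  dot (x + y) z = dot x z + dot y z.
Proof. by rewrite -big_split; apply: eq_bigr => i _; rewrite mxE mulrDl. Qed.

Lemma dotZl (R : realType) (m : nat) (a : R) (x z : 'rV[R]_m) :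
  dot (a *: x) z = a * dot x z.
Proof. by rewrite mulr_sumr; apply: eq_bigr => i _; rewrite mxE mulrA. Qed.

Lemma dotDr (R : realType) (m : nat) (x y z : 'rV[R]_m) :
  dot z (x + y) = dot z x + dot z y.
Proof. by rewrite dotC dotDl ![dot _ z]dotC. Qed.

Lemma dotZr (R : realType) (m : nat) (a : R) (x z : 'rV[R]_m) :
  dot z (a *: x) = a * dot z x.
Proof. by rewrite dotC dotZl dotC. Qed.

Lemma dotBl (R : realType) (m : nat) (x y z : 'rV[R]_m) :
  dot (x - y) z = dot x z - dot y z.
Proof. by rewrite dotDl -scaleN1r dotZl mulN1r. Qed.

Lemma dotBr (R : realType) (m : nat) (x y z : 'rV[R]_m) :
  dot z (x - y) = dot z x - dot z y.
Proof. by rewrite dotC dotBl ![dot _ z]dotC. Qed.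

Lemma dot_delta (R : realType) (m : nat) (x : 'rV[R]_m) (i : 'I_m) :
  dot x (delta_mx ord0 i) = x ord0 i.
Proof.
rewrite /dot (bigD1 i)//= mxE !eqxx mulr1 big1 ?addr0// => j ji.
by rewrite mxE (negbTE ji) andbF mulr0.
Qed.

Lemma dot_spacetime (R : realType) (n : nat) (s t : R) (x y : 'rV[R]_n) :
  dot (spacetime s x) (spacetime t y) = s * t + dot x y.
Proof.
rewrite /dot /spacetime big_split_ord big_ord1 !row_mxEl !mxE eqxx !mulr1n.
by congr (_ + _); apply: eq_bigr => i _; rewrite !row_mxEr.
Qed.

Lemma normr_dot_le (R : realType) (m : nat) (x y : 'rV[R]_m) :
  `|dot x y| <= m%:R * `|x| * `|y|.
Proof.
apply: le_trans (ler_norm_sum _ _ _) _.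
apply: (@le_trans _ _ (\sum_(i < m) `|x| * `|y|)).
  by apply: ler_sum => i _; rewrite normrM ler_pM// normr_rV_ge.
by rewrite sumr_const card_ord -[_ *+ _]mulr_natl mulrA.
Qed.

Lemma continuous_dist (R : realType) (V W : normedModType R) (f : V -> W) :
  (forall p (e : R), 0 < e -> \forall q \near p, `|f p - f q| < e) ->
  continuous f.
Proof. by move=> H p; apply/cvgrPdist_lt => e; exact: H. Qed.

Lemma continuous_distP (R : realType) (V W : normedModType R) (f : V -> W) p
    (e : R) : continuous f -> 0 < e ->
  exists2 d : R, 0 < d & forall q, `|p - q| < d -> `|f p - f q| < e.
Proof.
move=> cf e0; have /cvgrPdist_lt/(_ e e0)/nbhs_normP[d /= d0 dP] := cf p.
by exists d.
Qed.

Lemma continuous_sumr (R : realType) (T : topologicalType) (I : Type)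
    (r : seq I) (F : I -> T -> R) :
  (forall i, continuous (F i)) -> continuous (fun x => \sum_(i <- r) F i x).
Proof. by move=> Fc; apply: continuous_big => //; exact: add_continuous. Qed.

Lemma dot_continuous (R : realType) (m : nat) (q : 'rV[R]_m) :
  continuous (fun x => dot x q).
Proof.
apply: continuous_sumr => i x.
exact: (cvgM (@coord_continuous R 1 m ord0 i x) (cvg_cst (q ord0 i))).
Qed.

Lemma dot_continuousr (R : realType) (m : nat) (q : 'rV[R]_m) :
  continuous (dot q).
Proof.
have -> : dot q = fun x => dot x q by apply/funext => x; rewrite dotC.
exact: dot_continuous.
Qed.

Definition pairing (R : realType) (m : nat) (q x : 'rV[R]_m) : R := dot x q.

Lemma pairing_is_linear (R : realType) (m : nat) (q : 'rV[R]_m) :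
  linear (pairing q : 'rV[R]_m -> (R : normedModType R)).
Proof. by move=> a x y; rewrite /pairing dotDl dotZl. Qed.

HB.instance Definition _ (R : realType) (m : nat) (q : 'rV[R]_m) :=
  GRing.isLinear.Build R 'rV[R]_m (R : normedModType R) _ (pairing q)
    (pairing_is_linear q).

(** Difference quotients in direction [w] are at least [dot q w], hence so is the derivative;
    applied to [- w], this gives the reverse inequality. *)
Lemma subdifferential_differentiable (R : realType) (m : nat)
    (f : 'rV[R]_m -> R) (p q : 'rV[R]_m) : differentiable f p ->
  subdifferential f p q -> forall w, dot q w = 'd f p w.
Proof.
move=> df fq.
have le w : dot q w <= 'd f p w.
  rewrite -deriveE//; have := @diff_derivable _ _ _ f p w df.
  move=> dw; have := cvg_dnbhs_at_right dw.
  move=> dr; rewrite /derive -(cvg_lim _ dr)//.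
  apply: limr_ge; first by apply/cvg_ex; eexists; exact: dr.
  near=> h; have h0 : 0 < h by near: h; exact: nbhs_right_gt.
  rewrite /= -[leRHS]/(_ * _) ler_pdivlMl//.
  by have := fq (h *: w + p); rewrite addrK dotZr lerBrDl.
move=> w; apply/eqP; rewrite eq_le le/=.
by have := le (- w); rewrite linearN -scaleN1r dotZr mulN1r lerN2.
Unshelve. all: by end_near. Qed.

Lemma linear_approx_differentiable (R : realType) (V W : normedModType R)
    (f : V -> W) (L : {linear V -> W}) (p : V) : continuous L ->
  (forall e : R, 0 < e -> \forall h \near (0 : V),
     `|f (h + p) - f p - L h| <= e * `|h|) ->
  differentiable f p.
Proof.
move=> cL H.
have fo : f \o shift p = cst (f p) + L +o_ (0 : V) id.
  apply/eqaddoP => e e0; have := H e e0; apply: filterS => h.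
  by rewrite /= !fctE/= opprD addrA.
by apply/diff_locallyP; rewrite (diff_unique cL fo).
Qed.

Lemma dot_approx_differentiable (R : realType) (m : nat)
    (f : 'rV[R]_m -> R) (p q : 'rV[R]_m) :
  (forall e : R, 0 < e -> \forall h \near (0 : 'rV[R]_m),
     `|f (h + p) - f p - dot h q| <= e * `|h|) ->
  differentiable f p.
Proof.
exact: (@linear_approx_differentiable R 'rV[R]_m R f (pairing q) p
  (@dot_continuous R m q)).
Qed.

(** Attainment is part of the notion, so that subgradients can be read off from maximizers. For
    [legendre_potential] the slope map [Q] is [moment_lift]. *)
Definition max_affine (R : realType) (n m : nat) (P : set 'rV[R]_n)
    (Q : 'rV[R]_n -> 'rV[R]_m) (u : 'rV[R]_n -> R) (f : 'rV[R]_m -> R) :=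
  forall p, (exists2 y, P y & f p = dot p (Q y) - u y) /\
            (forall y, P y -> dot p (Q y) - u y <= f p).

Lemma max_affine_subgradient (R : realType) (n m : nat) (P : set 'rV[R]_n)
    (Q : 'rV[R]_n -> 'rV[R]_m) (u : 'rV[R]_n -> R) (f : 'rV[R]_m -> R) p y :
  max_affine P Q u f -> P y -> f p = dot p (Q y) - u y ->
  subdifferential f p (Q y).
Proof.
move=> mf Py fp p'; have [_ /(_ y Py)] := mf p'.
by rewrite fp dotBr ![dot (Q y) _]dotC; lra.
Qed.

(** A maximizer [y] gives the subgradient [Q y], and at a point of differentiability there is only
    one. *)
Lemma subdifferential_max_affine_differentiable (R : realType) (n m : nat)
    (P : set 'rV[R]_n) (Q : 'rV[R]_n -> 'rV[R]_m) (u : 'rV[R]_n -> R)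
    (f : 'rV[R]_m -> R) p :
  max_affine P Q u f -> differentiable f p ->
  subdifferential f p `<=` Q @` P.
Proof.
move=> mf df q fq; have [[y Py fy] _] := mf p; exists y => //.
have fQ := max_affine_subgradient mf Py fy.
apply/rowP => i; rewrite -!dot_delta.
by rewrite (subdifferential_differentiable df fQ)
           (subdifferential_differentiable df fq).
Qed.

Lemma max_affine_convex (R : realType) (n m : nat) (P : set 'rV[R]_n)
    (Q : 'rV[R]_n -> 'rV[R]_m) (u : 'rV[R]_n -> R) (f : 'rV[R]_m -> R)
    p p' (t : R) :
  max_affine P Q u f -> 0 <= t <= 1 ->
  f (t *: p + (1 - t) *: p') <= t * f p + (1 - t) * f p'.
Proof.
move=> mf /andP[t0 t1]; have [[y Py ->] _] := mf (t *: p + (1 - t) *: p').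
have [_ /(_ y Py) h] := mf p; have [_ /(_ y Py) h'] := mf p'.
rewrite dotDl !dotZl; have t1' : 0 <= 1 - t by rewrite subr_ge0.
have := ler_wpM2l t0 h; have := ler_wpM2l t1' h'; lra.
Qed.

Lemma max_affine_lipschitz (R : realType) (n m : nat) (P : set 'rV[R]_n)
    (Q : 'rV[R]_n -> 'rV[R]_m) (u : 'rV[R]_n -> R) (f : 'rV[R]_m -> R) :
  compact P -> continuous Q -> max_affine P Q u f ->
  exists B : R, [/\ 0 < B,
    forall y p, P y -> `|dot p (Q y)| <= B * `|p| &
    forall p p', `|f p - f p'| <= B * `|p - p'|].
Proof.
move=> cP cQ mf.
have : compact (Q @` P).
  by apply: continuous_compact => //; exact: continuous_subspaceT.
move=> /compact_bounded [B0 [_ Bb]].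
pose B := m.+1%:R * (`|B0| + 1).
have B_gt0 : 0 < B by rewrite mulr_gt0// ltr_wpDl.
have dB y p : P y -> `|dot p (Q y)| <= B * `|p|.
  move=> Py; apply: le_trans (normr_dot_le _ _) _.
  rewrite /B mulrAC ler_wpM2r// ler_pM// ?ler_nat//.
  by apply: Bb; [rewrite ltr_pwDr// ler_norm|exists y].
exists B; split => //.
have half p p' : f p - f p' <= B * `|p - p'|.
  have [[y Py ->] _] := mf p; have [_ /(_ y Py) h] := mf p'.
  have := dB y (p - p') Py; rewrite dotBl; move/(le_trans (ler_norm _)); lra.
move=> p p'; rewrite ler_norml half andbT lerNl opprB.
by rewrite -normrN opprB half.
Qed.

Lemma max_affine_continuous (R : realType) (n m : nat) (P : set 'rV[R]_n)
    (Q : 'rV[R]_n -> 'rV[R]_m) (u : 'rV[R]_n -> R) (f : 'rV[R]_m -> R) :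
  compact P -> continuous Q -> max_affine P Q u f -> continuous f.
Proof.
move=> cP cQ mf; have [B [B0 _ lip]] := max_affine_lipschitz cP cQ mf.
apply: (@continuous_dist _ 'rV[R]_m R) => p e e0.
have eB : 0 < e / B by rewrite divr_gt0.
apply: filterS (nbhsx_ballx p _ eB) => p'; rewrite -ball_normE/= => pp'.
by rewrite (le_lt_trans (lip _ _))// mulrC -ltr_pdivlMr.
Qed.

(** A form of Danskin's theorem. For a maximizer [y] at [h + p], the error of the linear
    approximation with slope [Q y0] lies between 0 and [dot h (Q y - Q y0)], and compactness makes
    [Q y] close to [Q y0] for small [h]. *)
Lemma max_affine_differentiable (R : realType) (n m : nat) (P : set 'rV[R]_n)
    (Q : 'rV[R]_n -> 'rV[R]_m) (u : 'rV[R]_n -> R) (f : 'rV[R]_m -> R) p :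
  compact P -> continuous Q -> continuous u -> max_affine P Q u f ->
  (forall y z, P y -> P z -> f p = dot p (Q y) - u y ->
     f p = dot p (Q z) - u z -> y = z) ->
  differentiable f p.
Proof.
move=> cP cQ cu mf uniq.
have [B [B0 dB lip]] := max_affine_lipschitz cP cQ mf.
have [[y0 Py0 fy0] _] := mf p.
have caff : continuous (fun y => dot p (Q y) - u y).
  move=> y; apply: (@continuousB R R _ (dot p \o Q) u y); last exact: cu.
  by apply: continuous_comp; [exact: cQ|exact: dot_continuousr].
apply: (@dot_approx_differentiable _ _ _ _ (Q y0)) => e e0.
pose eta := e / m.+1%:R.
have eta0 : 0 < eta by rewrite divr_gt0.
(* On [C] the maximand is bounded away from [f p], so maximizers at points
   near [p] lie outside [C]. *)
pose C := P `&` [set y | eta <= `|Q y0 - Q y|].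
have cC : compact C.
  apply: compact_closedI => //.
  apply: (@closed_comp _ _ (fun y => `|Q y0 - Q y|) [set r | eta <= r]).
    move=> y _; apply: (@continuous_comp _ _ _ (fun y => Q y0 - Q y) Num.norm).
      by apply: (@continuousB R 'rV[R]_m _ (cst (Q y0)) Q y);
        [exact: cst_continuous|exact: cQ].
    exact: norm_continuous.
  exact: closed_ge.
have [g g0 gC] : exists2 g : R, 0 < g &
    forall y, C y -> dot p (Q y) - u y <= f p - g.
  have [->|/set0P C0] := eqVneq C set0; first by exists 1.
  have [y1 /set_mem[Py1 y1far] y1max] := compact_EVT_max C0 cC
    (continuous_subspaceT caff).
  exists (f p - (dot p (Q y1) - u y1)).
    rewrite subr_gt0 lt_neqAle; have [_ /(_ _ Py1) ->] := mf p.
    rewrite andbT; apply/eqP => fy1.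
    have y01 : y0 = y1 by apply: uniq => //; rewrite fy1.
    by move: y1far; rewrite /= y01 subrr normr0 leNgt eta0.
  by move=> y Cy; rewrite subKr; apply: y1max; exact: mem_set.
(* Moving from [p] to [h + p] changes [f] and each maximand by at most [B * |h|]; the gap [g]
   survives as long as [2 * B * |h| < g]. *)
have r0 : 0 < g / (2 * B + 1) by rewrite divr_gt0// addr_gt0// mulr_gt0.
apply: filterS (nbhsx_ballx (0 : 'rV[R]_m) _ r0) => h.
rewrite -ball_normE/= sub0r normrN ltr_pdivlMr ?addr_gt0 ?mulr_gt0// => hr.
have [[y Py fy] _] := mf (h + p).
have fle : f p - f (h + p) <= B * `|h|.
  have := lip p (h + p); rewrite opprD addrCA subrr addr0 normrN.
  exact: le_trans (ler_norm _).
have nCy : `|Q y0 - Q y| < eta.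
  rewrite ltNge; apply/negP => far.
  have := gC y (conj Py far); have := dB y h Py.
  move/(le_trans (ler_norm _)).
  by move: fy; rewrite dotDl; have := normr_ge0 h; nra.
have lower : 0 <= f (h + p) - f p - dot h (Q y0).
  have [_ /(_ _ Py0)] := mf (h + p); rewrite dotDl fy0; lra.
have upper : f (h + p) - f p - dot h (Q y0) <= dot h (Q y - Q y0).
  have [_ /(_ _ Py)] := mf p; rewrite fy dotDl dotBr; lra.
rewrite ger0_norm//; apply: le_trans upper _.
apply: le_trans (ler_norm _) _; apply: le_trans (normr_dot_le _ _) _.
rewrite distrC in nCy.
have -> : e = m.+1%:R * eta by rewrite /eta mulrC divfK.
rewrite mulrAC ler_wpM2r//.
by apply: ler_pM => //; [rewrite ler_nat|exact: ltW].
Qed.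

(** * Space-time and subgradients over a slab *)

Lemma spacetimeK (R : realType) (n : nat) (p : 'rV[R]_(1 + n)) :
  spacetime (time p) (Defs.space p) = p.
Proof. by rewrite /spacetime /time -mx11_scalar hsubmxK. Qed.

Lemma time_spacetime (R : realType) (n : nat) (s : R) (x : 'rV[R]_n) :
  time (spacetime s x) = s.
Proof. by rewrite /time row_mxKl mxE mulr1n. Qed.

Lemma space_spacetime (R : realType) (n : nat) (s : R) (x : 'rV[R]_n) :
  Defs.space (spacetime s x) = x.
Proof. exact: row_mxKr. Qed.

Lemma spacetime_conv (R : realType) (n : nat) (t s s' : R) (x x' : 'rV[R]_n) :
  t *: spacetime s x + (1 - t) *: spacetime s' x' =
  spacetime (t * s + (1 - t) * s') (t *: x + (1 - t) *: x').
Proof.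
by rewrite /spacetime !scale_row_mx add_row_mx !scale_scalar_mx -raddfD.
Qed.

Lemma time_continuous (R : realType) (n : nat) : continuous (@time R n).
Proof.
have -> : @time R n = fun p => p ord0 (lshift n ord0).
  by apply/funext => p; rewrite /time mxE.
exact: coord_continuous.
Qed.

(** The slope in [(s, x)] of the maximand [dot x y - s * v y - u y]; its values form the graph of
    [- v], with the time component first. *)
Definition moment_lift (R : realType) (n : nat) (v : 'rV[R]_n -> R)
  (y : 'rV[R]_n) : 'rV[R]_(1 + n) := spacetime (- v y) y.

Lemma dot_moment_lift (R : realType) (n : nat) (v : 'rV[R]_n -> R)
    (s : R) (x y : 'rV[R]_n) :
  dot (spacetime s x) (moment_lift v y) = dot x y - s * v y.
Proof. by rewrite dot_spacetime mulrN addrC. Qed.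

Lemma moment_lift_continuous (R : realType) (n : nat) (v : 'rV[R]_n -> R) :
  continuous v -> continuous (moment_lift v).
Proof.
move=> cv; apply: (@continuous_dist R 'rV[R]_n 'rV[R]_(1 + n)) => y e e0.
have [d d0 dP] := continuous_distP (y) cv e0.
have m0 : 0 < Num.min d e by rewrite lt_min d0.
apply: filterS (nbhsx_ballx y _ m0) => z; rewrite -ball_normE/= lt_min.
move=> /andP[yd ye]; apply: normr_rV_lt => // i.
case: (split_ordP i) => j ->.
  rewrite mxE [X in _ + X]mxE /moment_lift /spacetime !row_mxEl [j]ord1 !mxE.
  by rewrite eqxx !mulr1n -opprD normrN dP.
rewrite mxE [X in _ + X]mxE /moment_lift /spacetime !row_mxEr.
by apply: le_lt_trans ye; have := normr_rV_ge (y - z) j; rewrite !mxE.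
Qed.

(** A subgradient at [p] means that [G] has a global minimum there. The ball of radius [rho] in [P]
    makes [G] coercive on the slab, the condition at time 0 bounds the minimum by [- u y], and the
    remaining two conditions bound [G] below by [- u y] outside the slab. *)
Lemma slab_subgradient (R : realType) (n : nat) (P : set 'rV[R]_n)
    (u v : 'rV[R]_n -> R) (f : 'rV[R]_(1 + n) -> R) (y : 'rV[R]_n)
    (rho T sigma : R) :
  compact P -> continuous u -> continuous v ->
  max_affine P (moment_lift v) u f ->
  P y -> 0 < rho -> (forall z, `|z - y| <= rho -> P z) ->
  (forall e : R, 0 < e -> exists x, f (spacetime 0 x) - dot x y <= - u y + e) ->
  0 < T -> - v y <= sigma ->
  (forall x, - u y <= f (spacetime T x) - dot x y - sigma * T) ->
  exists2 p, slab T p & subdifferential f p (spacetime sigma y).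
Proof.
move=> cP cu cv mf Py rho0 rhoP init T0 sv final.
pose G s x := f (spacetime s x) - dot x y - sigma * s.
have bnd (g : 'rV[R]_n -> R) : continuous g ->
    exists2 M : R, 0 < M & forall z, P z -> `|g z| <= M.
  move=> cg; have : compact (g @` P).
    by apply: continuous_compact => //; exact: continuous_subspaceT.
  move=> /compact_bounded [B [_ Bb]].
  exists (`|B| + 1); first by rewrite ltr_wpDl.
  by move=> z Pz; apply: Bb; [rewrite ltr_pwDr// ler_norm|exists z].
have [Mu Mu0 uM] := bnd u cu.
have [Mv Mv0 vM] := bnd v cv.
pose C := T * (Mv + `|sigma|) + Mu.
have coercive (s : R) (x : 'rV[R]_n) i :
    0 <= s <= T -> rho * `|x ord0 i| - C <= G s x.
  move=> /andP[s0 sT].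
  (* Shifting [y] by [rho] along the [i]-th axis, with the sign of the coordinate of [x], adds
     [rho * |x_i|] to the maximand; [C] collects the bounded terms. *)
  pose z := y + (rho * Num.sg (x ord0 i)) *: delta_mx ord0 i.
  have Pz : P z.
    apply: rhoP; rewrite /z addrC addKr normrZ.
    rewrite normrM (gtr0_norm rho0) -mulrA ler_piMr ?(ltW rho0)//.
    have d1 : `|(delta_mx ord0 i : 'rV[R]_n)| <= 1.
      rewrite [leLHS]/Num.norm/= mx_normrE; apply/bigmax_leP; split => // j _.
      by rewrite mxE; case: (_ && _); rewrite ?normr1 ?normr0.
    by rewrite -[leRHS]mulr1 ler_pM// normr_sg; case: (_ != _).
  have [_ /(_ z Pz)] := mf (spacetime s x).
  rewrite dot_moment_lift /G {1}/z dotDr dotZr dot_delta.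
  rewrite -mulrA -normrEsg.
  have vz : s * v z <= T * Mv.
    apply: (@le_trans _ _ (s * Mv)); last by rewrite ler_wpM2r// ltW.
    by rewrite ler_wpM2l// (le_trans (ler_norm _))// vM.
  have sz : sigma * s <= T * `|sigma|.
    rewrite mulrC (@le_trans _ _ (s * `|sigma|))//; last by rewrite ler_wpM2r.
    by rewrite ler_wpM2l// ler_norm.
  have uz := le_trans (ler_norm _) (uM z Pz).
  by rewrite /C; lra.
(* Chosen so that [G s x <= - u y + 1] forces every coordinate of [x] into [[- L, L]]. *)
pose L := (C + 1 + Mu) / rho.
have L0 : 0 <= L.
  rewrite divr_ge0 ?(ltW rho0)// /C.
  have : 0 <= T * (Mv + `|sigma|).
    by rewrite mulr_ge0 ?(ltW T0)// addr_ge0 ?(ltW Mv0).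
  lra.
pose A (i : 'I_(1 + n)) : set R :=
  if fintype.split i is inl _ then `[0, T]%classic else `[- L, L]%classic.
pose K : set 'rV[R]_(1 + n) := [set p | forall i, A i (p ord0 i)].
have KE s x : K (spacetime s x) <->
    0 <= s <= T /\ forall i, `|x ord0 i| <= L.
  split=> [H|[sT xL] i].
    split=> [|i].
      have := H (lshift n ord0); rewrite /A (unsplitK (inl _)) /spacetime.
      by rewrite row_mxEl mxE mulr1n/= in_itv.
    have := H (rshift 1 i); rewrite /A (unsplitK (inr _)) /spacetime.
    by rewrite row_mxEr/= in_itv/= ler_norml.
  case: (split_ordP i) => j ->; rewrite /A /spacetime.
    by rewrite (unsplitK (inl _)) row_mxEl [j]ord1 mxE mulr1n/= in_itv.
  by rewrite (unsplitK (inr _)) row_mxEr/= in_itv/= -ler_norml.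
have cK : compact K.
  apply: (@rV_compact _ _ A) => i.
  by rewrite /A; case: (fintype.split i) => _; exact: segment_compact.
have lowK s x : 0 <= s <= T -> G s x <= - u y + 1 -> K (spacetime s x).
  move=> sT Gle; apply/KE; split => // i.
  rewrite /L ler_pdivlMr// mulrC.
  have := coercive s x i sT; have := uM y Py; rewrite ler_norml => /andP[? ?].
  lra.
have GE p : f p - dot p (spacetime sigma y) = G (time p) (Defs.space p).
  by rewrite -{1 2}(spacetimeK p) dot_spacetime /G mulrC; ring.
have cG : continuous (fun p => f p - dot p (spacetime sigma y)).
  move=> p.
  apply: (@continuousB R R _ f (fun p => dot p (spacetime sigma y)) p).
    by apply: max_affine_continuous; [exact: cP| |exact: mf];
      exact: moment_lift_continuous.
  exact: dot_continuous.
have [x1 x1P] := init 1 ltr01.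
have K0 : K !=set0.
  exists (spacetime 0 x1); apply: lowK; first by rewrite lexx ltW.
  by rewrite /G mulr0 subr0.
have [p /set_mem Kp pmin] := compact_EVT_min K0 cK (continuous_subspaceT cG).
have Gp : f p - dot p (spacetime sigma y) <= - u y.
  apply/ler_addgt0Pr => e e0.
  (* The slack is capped at 1 so that the approximate minimizer lies in [K]. *)
  have m0 : 0 < Num.min e 1 by rewrite lt_min e0 ltr01.
  have [x xP] := init _ m0.
  have Kx : K (spacetime 0 x).
    apply: lowK; first by rewrite lexx ltW.
    rewrite /G mulr0 subr0 (le_trans xP)// lerD2l ge_min lexx orbT//.
  apply: (le_trans (pmin _ (mem_set Kx))).
  rewrite GE time_spacetime space_spacetime /G mulr0 subr0 (le_trans xP)//.
  by rewrite lerD2l ge_min lexx.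
exists p.
  by move: Kp; rewrite -(spacetimeK p) => /KE[]; rewrite /slab/= time_spacetime.
move=> p'; rewrite dotBr ![dot (spacetime sigma y) _]dotC.
suff : f p - dot p (spacetime sigma y) <=
    f p' - dot p' (spacetime sigma y) by lra.
rewrite [leRHS]GE; set s := time p'; set x := Defs.space p'.
(* For negative time, the maximand at [y] gives [G s x >= - u y - s * (v y + sigma)], and the last
   product is nonpositive. *)
have [s0|s0] := ltP s 0.
  apply: (le_trans Gp).
  have [_ /(_ y Py)] := mf (spacetime s x); rewrite dot_moment_lift /G; nra.
have [sT|sT] := leP s T.
  have [Gle|/ltW Gge] := leP (G s x) (- u y + 1).
    have := pmin _ (mem_set (lowK s x _ Gle)).
    rewrite s0 sT => /(_ isT).
    by rewrite [leRHS]GE time_spacetime space_spacetime.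
  by apply: (le_trans Gp); apply: le_trans Gge; rewrite lerDl.
apply: (le_trans Gp); apply/ler_addgt0Pr => e e0.
have s_gt0 : 0 < s by exact: lt_trans sT.
(* The segment from [(0, x0)] to [(s, x)] crosses time [T] at parameter [t]. The slack at [x0] is
   [e * t] because the convexity inequality is finally divided by [t]. *)
pose t := T / s.
have t0 : 0 < t by rewrite divr_gt0.
have t1 : t < 1 by rewrite ltr_pdivrMr// mul1r.
have et0 : 0 < e * t by rewrite mulr_gt0.
have [x0 x0P] := init _ et0.
have t01 : 0 <= t <= 1 by rewrite !ltW.
have := max_affine_convex (spacetime s x) (spacetime 0 x0) mf t01.
rewrite spacetime_conv mulr0 addr0 (_ : t * s = T); last first.
  by rewrite /t divfK// gt_eqF.
have := final (t *: x + (1 - t) *: x0); rewrite dotDl !dotZl.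
have ts : t * s = T by rewrite /t divfK// gt_eqF.
move=> h1 h2.
have t1' : 0 <= 1 - t by lra.
have h3 := ler_wpM2l t1' x0P.
have h4 : (1 - t) * (e * t) <= e * t by rewrite ler_piMl ?ltW//; lra.
suff : t * (- u y) <= t * (G s x + e) by rewrite ler_pM2l.
by rewrite /G; nra.
Qed.

(** * Polytopes *)

(** The function vanishes for [x <= 0], where [ln] is 0. On the right of 0, the bound [ln z <= z] at
    [z = 1 / sqrt x] gives [|x * ln x| <= 2 * sqrt x]. *)
Lemma xlnx_continuous (R : realType) : continuous (fun x : R => x * ln x).
Proof.
have ln0' (x : R) : x <= 0 -> x * ln x = 0 by move=> x0; rewrite ln0 ?mulr0.
have small (x : R) : 0 < x -> x <= 1 -> `|x * ln x| <= 2 * Num.sqrt x.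
  move=> x0 x1; have s0 : 0 < Num.sqrt x by rewrite sqrtr_gt0.
  have lnx : ln x = - (2 * ln (Num.sqrt x)^-1).
    rewrite lnV ?posrE// mulrN opprK -{1}(sqr_sqrtr (ltW x0)) lnXn//.
    by rewrite mulr_natl.
  have l1 : ln (Num.sqrt x)^-1 <= (Num.sqrt x)^-1.
    by rewrite ltW// ln_sublinear// invr_gt0.
  rewrite ler0_norm; last exact: (mulr_ge0_le0 (ltW x0) (ln_le0 x1)).
  rewrite lnx mulrN opprK mulrCA ler_pM2l//.
  apply: (@le_trans _ _ (x * (Num.sqrt x)^-1)); first by rewrite ler_pM2l.
  by rewrite -{1}(sqr_sqrtr (ltW x0)) expr2 mulfK// gt_eqF.
move=> x; have [x0|x0|->] := ltgtP x 0.
- apply: (@near_cst_continuous _ _ 0).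
  near=> y; apply: ln0'; apply: ltW; near: y.
  exact: lt_nbhsl.
- exact: (cvgM (@cvg_id R (nbhs x)) (continuous_ln x0)).
- apply/(@cvgrPdist_lt R R) => e e0; rewrite mul0r.
  have d0 : 0 < Num.min 1 ((e / 2) ^+ 2).
    by rewrite lt_min ltr01 exprn_gt0// divr_gt0.
  apply: filterS (nbhsx_ballx (0 : R) _ d0) => y; rewrite -ball_normE/=.
  rewrite !sub0r !normrN lt_min => /andP[y1 ye].
  have [y0|y0] := leP y 0; first by rewrite ln0' ?normr0.
  rewrite gtr0_norm// in y1 ye.
  apply: le_lt_trans (small _ y0 (ltW y1)) _.
  rewrite mulrC -ltr_pdivlMr// -(ger0_norm (ltW (divr_gt0 e0 _)))// -sqrtr_sqr.
  by rewrite ltr_sqrt// exprn_gt0// divr_gt0.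
Unshelve. all: by end_near. Qed.

Lemma smooth_on_continuous (R : realType) (V W : normedModType R) (f : V -> W) :
  smooth_on setT f -> continuous f.
Proof. by move=> sf x; exact: (sf 0%N). Qed.

Lemma interior_ball (R : realType) (V : normedModType R) (A : set V) (y : V) :
  A° y -> exists2 r : R, 0 < r & forall z, `|z - y| < r -> A z.
Proof.
move=> /nbhs_normP[r /= r0 rA].
by exists r => // z zy; apply: rA; rewrite /= distrC.
Qed.

Lemma ball_interior (R : realType) (V : normedModType R) (A : set V) (y : V)
    (r : R) : 0 < r -> (forall z, `|z - y| < r -> A z) -> A° y.
Proof.
move=> r0 rA; apply/nbhs_normP.
by exists r => //= z zy; apply: rA; rewrite distrC.
Qed.

Section polytope.
Variables (R : realType) (n d : nat).
Variables (nu : 'I_d -> 'rV[int]_n) (lam : 'I_d -> R).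
Let P := polytope nu lam.

Lemma facet_fun_conv k (t : R) (a b : 'rV[R]_n) :
  facet_fun nu lam k (t *: a + (1 - t) *: b) =
  t * facet_fun nu lam k a + (1 - t) * facet_fun nu lam k b.
Proof. by rewrite /facet_fun dotDl !dotZl; ring. Qed.

Lemma facet_fun_continuous k : continuous (facet_fun nu lam k).
Proof.
move=> y; apply: (@continuousB R R _ (fun y => dot y (map_mx intr (nu k)))
  (cst (lam k)) y); [exact: dot_continuous|exact: cst_continuous].
Qed.

Lemma polytope_conv (t : R) (a b : 'rV[R]_n) : 0 <= t <= 1 ->
  P a -> P b -> P (t *: a + (1 - t) *: b).
Proof.
move=> /andP[t0 t1] Pa Pb k; rewrite facet_fun_conv.
by rewrite addr_ge0// mulr_ge0// subr_ge0.
Qed.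

Lemma polytope_closed : closed P.
Proof.
have -> : P = \bigcap_k [set y | 0 <= facet_fun nu lam k y].
  by apply/seteqP; split => y Py k; [move=> _; exact: Py|exact: Py].
apply: closed_bigI => k _.
apply: (@closed_comp _ _ (facet_fun nu lam k) [set r | 0 <= r]).
  by move=> y _; exact: facet_fun_continuous.
exact: closed_ge.
Qed.

(** A point within [t * r] of the combination is itself a combination of [a] and a point within [r]
    of [z], with the same weights. *)
Lemma polytope_interior_conv (t : R) (a z : 'rV[R]_n) : 0 < t <= 1 ->
  P a -> P° z -> P° (t *: z + (1 - t) *: a).
Proof.
move=> /andP[t0 t1] Pa /interior_ball[r r0 rP].
apply: (@ball_interior R 'rV[R]_n _ _ (t * r)); first by rewrite mulr_gt0.
move=> w wr; pose c := t *: z + (1 - t) *: a.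
have -> : w = t *: (z + t^-1 *: (w - c)) + (1 - t) *: a.
  by rewrite scalerDr scalerA divff ?gt_eqF// scale1r addrAC addrC subrK.
apply: polytope_conv => //; first by rewrite (ltW t0).
apply: rP; rewrite addrC addKr normrZ gtr0_norm ?invr_gt0//.
by rewrite ltr_pdivrMl.
Qed.

Lemma continuous_line (W : 'rV[R]_n -> R) (a w : 'rV[R]_n) (e : R) :
  continuous W -> 0 < e ->
  exists2 r : R, 0 < r & forall t, 0 <= t < r -> `|W a - W (a + t *: w)| < e.
Proof.
move=> cW e0; have [r r0 rW] := continuous_distP a cW e0.
have w0 : 0 < `|w| + 1 by rewrite ltr_wpDl.
exists (r / (`|w| + 1)); first by rewrite divr_gt0.
move=> t /andP[t0]; rewrite ltr_pdivlMr// => tr; apply: rW.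
rewrite opprD addNKr normrN normrZ ger0_norm//.
by apply: le_lt_trans tr; rewrite ler_wpM2l// lerDl.
Qed.

(** Both end points are moved by a small factor [h] towards an interior point [z]; their combination
    moves in the same way, and continuity absorbs the three errors. *)
Lemma convex_closure (W : 'rV[R]_n -> R) (t : R) (a b : 'rV[R]_n) :
  continuous W -> P° !=set0 -> 0 <= t <= 1 ->
  (forall a b, P° a -> P° b ->
     W (t *: a + (1 - t) *: b) <= t * W a + (1 - t) * W b) ->
  P a -> P b -> W (t *: a + (1 - t) *: b) <= t * W a + (1 - t) * W b.
Proof.
move=> cW [z Pz] t01 Wc Pa Pb; apply/ler_addgt0Pr => e e0.
have e2 : 0 < e / 2 by rewrite divr_gt0.
pose y := t *: a + (1 - t) *: b.
have [ra ra0 raW] := continuous_line a (z - a) cW e2.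
have [rb rb0 rbW] := continuous_line b (z - b) cW e2.
have [ry ry0 ryW] := continuous_line y (z - y) cW e2.
pose r := Num.min (Num.min ra rb) (Num.min ry 1).
have r0 : 0 < r by rewrite !lt_min ra0 rb0 ry0 ltr01.
pose h := r / 2.
have h0 : 0 < h by rewrite divr_gt0.
have hr : h < r by rewrite /h; lra.
have := hr; rewrite {1}/r !lt_min => /andP[/andP[ha hb] /andP[hy h1]].
have h01 : 0 < h <= 1 by rewrite h0 ltW.
have lineE c : c + h *: (z - c) = h *: z + (1 - h) *: c.
  by rewrite scalerBr scalerBl scale1r addrCA.
have Ia : P° (a + h *: (z - a)).
  by rewrite lineE; exact: polytope_interior_conv.
have Ib : P° (b + h *: (z - b)).
  by rewrite lineE; exact: polytope_interior_conv.
have := Wc _ _ Ia Ib.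
have -> : t *: (a + h *: (z - a)) + (1 - t) *: (b + h *: (z - b)) =
    y + h *: (z - y).
  by apply/rowP => i; rewrite /y !mxE; ring.
have hge := ltW h0.
have := raW h; rewrite ha hge => /(_ isT); rewrite ltr_norml => /andP[a1 _].
have := rbW h; rewrite hb hge => /(_ isT); rewrite ltr_norml => /andP[b1 _].
have := ryW h; rewrite hy hge => /(_ isT); rewrite ltr_norml => /andP[_ y1].
move: t01 => /andP[t0 t1].
have t1' : 0 <= 1 - t by lra.
set Wa := W (a + _) in a1 *; set Wb := W (b + _) in b1 *.
have k1 : t * Wa <= t * (W a + e / 2) by rewrite ler_wpM2l//; lra.
have k2 : (1 - t) * Wb <= (1 - t) * (W b + e / 2) by rewrite ler_wpM2l//; lra.
lra.
Qed.

End polytope.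

(** ['D_w] reads only values on the line through [y], so this applies to [u0] along a face, at a
    boundary point of the polytope. *)
Lemma affine_line_derive2 (R : realType) (n : nat) (g : 'rV[R]_n -> R)
    (y w : 'rV[R]_n) (c beta r : R) : 0 < r ->
  (forall h, `|h| < r -> g (h *: w + y) = c + h * beta) ->
  'D_w ('D_w g) y = 0.
Proof.
move=> r0 gE.
have D1 h : `|h| < r -> 'D_w g (h *: w + y) = beta.
  move=> hr; have rh : 0 < r - `|h| by rewrite subr_gt0.
  apply/lim_near_cst => //=; near=> k.
  have k0 : k != 0 by near: k; exact: nbhs_dnbhs_neq.
  have kr : `|k| < r - `|h| by near: k; exact: dnbhs0_lt.
  rewrite addrA -scalerDl !gE//; last first.
    by rewrite (le_lt_trans (ler_normD _ _))//; lra.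
  by rewrite -[LHS]/(_ * _); field.
apply/lim_near_cst => //=; near=> k.
have kr : `|k| < r by near: k; exact: dnbhs0_lt.
have := D1 0; rewrite normr0 scale0r add0r => -> //.
by rewrite D1// subrr scaler0.
Unshelve. all: by end_near. Qed.

(** * Toric Cauchy data *)

(** The data are controlled on [P] alone, so continuous functions [u] and [v] agreeing with them
    there take their place; compactness makes the supremum attained. *)
Lemma max_affine_legendre (R : realType) (n : nat) (P : set 'rV[R]_n)
    (u0 du0 u v : 'rV[R]_n -> R) (psi := legendre_potential P u0 du0) :
  compact P -> P !=set0 -> continuous u -> continuous v ->
  (forall y, P y -> u0 y = u y) -> (forall y, P y -> du0 y = v y) ->
  (forall p, psi p \is a fin_num) /\
  max_affine P (moment_lift v) u (fine \o psi).
Proof.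
move=> cP P0 cu cv u0E du0E.
have key p : exists2 y, P y & psi p = (dot p (moment_lift v y) - u y)%:E /\
    forall z, P z ->
      dot p (moment_lift v z) - u z <= dot p (moment_lift v y) - u y.
  have cphi : continuous (fun y => dot p (moment_lift v y) - u y).
    move=> y; apply: (@continuousB R R _ (dot p \o moment_lift v) u y);
      last exact: cu.
    apply: continuous_comp; first exact: moment_lift_continuous.
    exact: dot_continuousr.
  have [y /set_mem Py ymax] :=
    compact_EVT_max P0 cP (continuous_subspaceT cphi).
  have ymax' z : P z ->
      dot p (moment_lift v z) - u z <= dot p (moment_lift v y) - u y.
    by move=> Pz; apply: ymax; exact: mem_set.
  have termE z : P z ->
      dot (Defs.space p) z - (u0 z + time p * du0 z) =
      dot p (moment_lift v z) - u z.
    move=> Pz; rewrite -{3}(spacetimeK p) dot_moment_lift u0E// du0E//; ring.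
  exists y => //; split => //; apply/eqP; rewrite eq_le; apply/andP; split.
    by apply: ge_ereal_sup => _ [z Pz <-]; rewrite termE// lee_fin ymax'.
  by apply: ereal_sup_ubound; exists y => //; rewrite termE.
split=> [p|p]; have [y Py [psiE ymax]] := key p; first by rewrite psiE.
by split=> [|z Pz]; rewrite /= psiE/=; [exists y|exact: ymax].
Qed.

Lemma slab_borel (R : realType) (n : nat) (T : R) : borel (@slab R n T).
Proof.
have [_ hC _] := @smallest_sigma_algebra 'rV[R]_(1 + n) setT [set A | open A].
have -> : @slab R n T = setT `\` ~` slab T by rewrite setTD setCK.
apply: hC; apply: sub_sigma_algebra.
apply: closed_openC.
apply: (@closed_comp _ _ (@time R n) `[0, T]%classic); last first.
  exact: interval_closed.
by move=> p _; exact: time_continuous.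
Qed.

Section toric.
Variables (R : realType) (n d : nat).
Variables (nu : 'I_d -> 'rV[int]_n) (lam : 'I_d -> R).
Variables (psi0 dpsi0 du0 : 'rV[R]_n -> R).
Hypothesis data : toric_cauchy_data nu lam psi0 dpsi0 du0.

Let P := polytope nu lam.
Let u0 := dual_potential psi0.
Let psi := legendre_potential P u0 du0.

Lemma polytope_compact : compact P.
Proof.
apply: bounded_closed_compact; last exact: polytope_closed.
exact: delzant_bounded (tcd_delzant data).
Qed.

(** Guillemin's formula defines a continuous function on the whole space, as [x * ln x] is
    continuous on the whole line. *)
Lemma dual_potential_continuous :
  exists2 u, continuous u & forall y, P y -> u0 y = u y.
Proof.
have [c [F [c0 [G sG FG] legE]]] := kp_guillemin (tcd_potential data).
pose ent y := \sum_(k < d) facet_fun nu lam k y * ln (facet_fun nu lam k y).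
exists (fun y => c * ent y + G y); last first.
  by move=> y Py; rewrite /u0 /dual_potential legE//= FG.
have sc : continuous ent.
  apply: continuous_sumr => k y.
  exact: (continuous_comp (@facet_fun_continuous _ _ _ nu lam k y)
    (@xlnx_continuous R _)).
have cG : continuous G by exact: smooth_on_continuous.
move=> y; exact: (cvgD (cvgM (cvg_cst c) (sc y)) (cG y)).
Qed.

Lemma du0_continuous : exists2 v, continuous v & forall y, P y -> du0 y = v y.
Proof.
have [v sv vE] := tcd_du0_smooth data.
by exists v => //; exact: smooth_on_continuous.
Qed.

Lemma fenchel_ineq x y : P y -> dot x y - psi0 x <= u0 y.
Proof.
move=> Py; have [c [F [_ _ legE]]] := kp_guillemin (tcd_potential data).
rewrite -lee_fin /u0 /dual_potential fineK; last by rewrite legE.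
by apply: ereal_sup_ubound; exists x => //; rewrite dotC.
Qed.

Lemma dual_potential_adherent y e : P y -> 0 < e ->
  exists x, u0 y - e < dot x y - psi0 x.
Proof.
move=> Py e0; have [c [F [_ _ legE]]] := kp_guillemin (tcd_potential data).
have fin : legendre setT psi0 y \is a fin_num by rewrite legE.
have [_ [x _ <-]] := ub_ereal_sup_adherent e0 fin.
rewrite -/(legendre setT psi0 y) -(fineK fin) -EFinB lte_fin => h.
by exists x; rewrite [dot x y]dotC.
Qed.

Lemma dual_potential_convex t a b : 0 <= t <= 1 -> P a -> P b ->
  u0 (t *: a + (1 - t) *: b) <= t * u0 a + (1 - t) * u0 b.
Proof.
move=> t01 Pa Pb; apply/ler_addgt0Pr => e e0.
have [x] := dual_potential_adherent (polytope_conv t01 Pa Pb) e0.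
rewrite dotDr !dotZr; have := fenchel_ineq x Pa; have := fenchel_ineq x Pb.
move: t01 => /andP[t0 t1]; have t1' : 0 <= 1 - t by lra.
move=> /(ler_wpM2l t1') h1 /(ler_wpM2l t0) h2; lra.
Qed.

Lemma range_grad : range (grad psi0) = P°.
Proof.
have [[fun_ _ surj] _ _] := kp_diffeo (tcd_potential data).
by apply/seteqP; split => [_ [x _ <-]|y /surj]; [exact: fun_|].
Qed.

(** Turns the convexity in the lifespan into an inequality for [u0 + s * du0], using that [du0] is
    the pulled-back velocity on the interior. *)
Lemma convex_lifespanE s :
  convex_function (range (grad psi0))
    (fun y => u0 y - s * dpsi0 (inverse_map (grad psi0) y)) <->
  (forall t a b, 0 <= t <= 1 -> P° a -> P° b ->
     u0 (t *: a + (1 - t) *: b) + s * du0 (t *: a + (1 - t) *: b) <=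
     t * (u0 a + s * du0 a) + (1 - t) * (u0 b + s * du0 b)).
Proof.
have E y : P° y ->
    u0 y - s * dpsi0 (inverse_map (grad psi0) y) = u0 y + s * du0 y.
  by move=> Py; rewrite (tcd_du0 data Py) mulrN.
have Pconv t a b : 0 <= t <= 1 -> P° a -> P° b -> P° (t *: a + (1 - t) *: b).
  move=> /andP[t0 t1] Pa Pb; have [->|tn0] := eqVneq t 0.
    by rewrite scale0r add0r subr0 scale1r.
  apply: polytope_interior_conv => //; last exact: interior_subset.
  by rewrite t1 lt_neqAle eq_sym tn0 t0.
rewrite range_grad.
split => [H t a b t01 Pa Pb|H t a b /set_mem Pa /set_mem Pb].
  move: (t01) => /andP[t0 t1]; pose i := Itv01 t0 t1.
  pose g y := u0 y - s * dpsi0 (inverse_map (grad psi0) y).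
  have : g (t *: a + (1 - t) *: b) <= t * g a + (1 - t) * g b.
    exact: (H i a b (mem_set Pa) (mem_set Pb)).
  by rewrite /g !E//; exact: Pconv.
pose g y := u0 y - s * dpsi0 (inverse_map (grad psi0) y).
suff : g (t%:num *: a + (1 - t%:num) *: b) <=
    t%:num * g a + (1 - t%:num) * g b by [].
have t01 : 0 <= t%:num <= 1 by rewrite ge0 le1.
by rewrite /g !E//; [exact: H|exact: Pconv].
Qed.

Lemma dual_potential_not_affine (a b : 'rV[R]_n) : P a -> P b -> a != b ->
  exists2 t : R, 0 <= t <= 1 &
    u0 (t *: a + (1 - t) *: b) != t * u0 a + (1 - t) * u0 b.
Proof.
move=> Pa Pb ab; apply: contrapT => noaff.
have aff t : 0 <= t <= 1 ->
    u0 (t *: a + (1 - t) *: b) = t * u0 a + (1 - t) * u0 b.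
  by move=> t01; apply/eqP; apply: contrapT => /negP h; apply: noaff; exists t.
pose w := a - b; pose y := 2^-1 *: a + (1 - 2^-1) *: b.
have half01 : 0 <= (2^-1 : R) <= 1 by apply/andP; split; lra.
have Py : P y by exact: polytope_conv.
have w0 : w != 0 by rewrite subr_eq0.
(* A facet function vanishing at the midpoint [y] is nonnegative at [a] and [b] with mean 0, so it
   vanishes at both: [w] is a face direction. *)
have face k : k \in active nu lam y -> dot w (map_mx intr (nu k)) = 0.
  rewrite inE facet_fun_conv => /eqP.
  have := Pa k; have := Pb k; rewrite /facet_fun dotBl; lra.
have half0 : 0 < (2^-1 : R) by lra.
suff uE h : `|h| < 2^-1 -> u0 (h *: w + y) =
    (2^-1 * u0 a + (1 - 2^-1) * u0 b) + h * (u0 a - u0 b).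
  have := kp_face_hess (tcd_potential data) Py w0 face.
  by rewrite (affine_line_derive2 half0 uE) ltxx.
rewrite ltr_norml => /andP[h1 h2].
have -> : h *: w + y = (2^-1 + h) *: a + (1 - (2^-1 + h)) *: b.
  by apply/rowP => i; rewrite /w /y !mxE; ring.
by rewrite aff; [ring|apply/andP; split; lra].
Qed.

(** * Before and after the convex lifespan *)

Lemma regular_before_lifespan p : 0 <= time p ->
  ((time p)%:E < convex_lifespan psi0 dpsi0)%E -> regular_locus psi p.
Proof.
move=> s0 /ereal_sup_gt[_ [s' [s'0 /convex_lifespanE s'c] <-]].
rewrite lte_fin => ss'.
have [u cu uE] := dual_potential_continuous.
have [v cv vE] := du0_continuous.
have cP := polytope_compact.
have [z Pz] := delzant_full (tcd_delzant data).
have P0 : P !=set0 by exists z; exact: interior_subset.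
have [fin mf] := max_affine_legendre cP P0 cu cv uE vE.
split => //; apply: (max_affine_differentiable cP _ cu mf).
  exact: moment_lift_continuous.
move=> a b Pa Pb fa fb; apply/eqP; apply: contrapT => /negP ab.
have [t t01 /eqP] := dual_potential_not_affine Pa Pb ab; apply.
pose y := t *: a + (1 - t) *: b.
have Py : P y by exact: polytope_conv.
have cW : continuous (fun y => u y + s' * v y).
  move=> x; exact: (cvgD (cu x) (cvgM (cvg_cst s') (cv x))).
have := convex_closure cW (delzant_full (tcd_delzant data)) t01 _ Pa Pb.
have int_conv c e : P° c -> P° e ->
    u (t *: c + (1 - t) *: e) + s' * v (t *: c + (1 - t) *: e) <=
    t * (u c + s' * v c) + (1 - t) * (u e + s' * v e).
  move=> Ic Ie; have := s'c t c e t01 Ic Ie.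
  have Pc := interior_subset Ic; have Pe := interior_subset Ie.
  by have Pce := polytope_conv t01 Pc Pe; rewrite !uE// !vE.
move=> /(_ int_conv) Wle.
have := dual_potential_convex t01 Pa Pb; rewrite !uE//.
move=> ule; apply/eqP; rewrite eq_le ule/=.
have [_ /(_ y Py)] := mf p.
move: fa fb; rewrite -(spacetimeK p) !dot_moment_lift /= dotDr !dotZr.
set f := fine _ => fa fb.
have -> : f = t * f + (1 - t) * f by ring.
rewrite {1}fa fb; rewrite -/y in Wle ule *.
set s := time p in s0 ss' *; move=> hy.
(* Subtracting the two inequalities eliminates [v], since [s' * (u + s * v) - s * (u + s' * v) = (s'
   - s) * u]. *)
have hs : s * (u y + s' * v y) <=
    s * (t * (u a + s' * v a) + (1 - t) * (u b + s' * v b)).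
  exact: ler_wpM2l.
have hs' : s' * (t * (u a + s * v a) + (1 - t) * (u b + s * v b)) <=
    s' * (u y + s * v y).
  by apply: ler_wpM2l => //; lra.
have ds : 0 < s' - s by lra.
by rewrite -(ler_pM2l ds); lra.
Qed.

Lemma lifespan_ge0 : (0 <= convex_lifespan psi0 dpsi0)%E.
Proof.
apply: ereal_sup_ubound; exists 0 => //; split => //.
apply/convex_lifespanE => t a b t01 Ia Ib; rewrite !mul0r !addr0.
by apply: (dual_potential_convex t01); exact: interior_subset.
Qed.

Lemma slab_subdifferential_box T : (convex_lifespan psi0 dpsi0 < T%:E)%E ->
  exists a b : 'rV[R]_(1 + n), 0 < box_volume a b /\
    box a b `<=` \bigcup_(p in slab T) subdifferential (fine \o psi) p.
Proof.
move=> LT.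
have T0 : 0 < T by rewrite -lte_fin; exact: le_lt_trans lifespan_ge0 LT.
have [u cu uE] := dual_potential_continuous.
have [v cv vE] := du0_continuous.
have cP := polytope_compact.
have [z Pz] := delzant_full (tcd_delzant data).
have P0 : P !=set0 by exists z; exact: interior_subset.
have [_ mf] := max_affine_legendre cP P0 cu cv uE vE.
pose W y := u y + T * v y.
have cW : continuous W.
  move=> x; exact: (cvgD (cu x) (cvgM (cvg_cst T) (cv x))).
(* Otherwise [T] itself would be one of the times whose supremum is the lifespan. *)
have [t [a [b [t01 Ia Ib gap]]]] : exists t a b, [/\ 0 <= t <= 1, P° a, P° b &
    t * W a + (1 - t) * W b < W (t *: a + (1 - t) *: b)].
  apply: contrapT => nogap; move: LT; rewrite ltNge => /negP; apply.
  apply: ereal_sup_ubound; exists T => //; split; first exact: ltW.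
  apply/convex_lifespanE => t a b t01 Ia Ib.
  have Pa := interior_subset Ia; have Pb := interior_subset Ib.
  have Pab := polytope_conv t01 Pa Pb.
  rewrite !uE// !vE//; rewrite leNgt; apply/negP => gap.
  by apply: nogap; exists t, a, b.
pose y0 := t *: a + (1 - t) *: b.
pose gam := W y0 - (t * W a + (1 - t) * W b).
have gam0 : 0 < gam by rewrite subr_gt0.
have gam4 : 0 < gam / 4 by rewrite divr_gt0.
(* Raising [sigma] by [eta] costs [gam / 2] at time [T], the part of the gap that is kept near
   [y0]. *)
pose eta := gam / (2 * T).
have eta0 : 0 < eta by rewrite divr_gt0// mulr_gt0.
have etaT : eta * T = gam / 2 by rewrite /eta; field; rewrite gt_eqF.
have eta4 : 0 < eta / 4 by rewrite divr_gt0.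
have [ra ra0 raP] := interior_ball Ia.
have [rb rb0 rbP] := interior_ball Ib.
have [da da0 daW] := continuous_distP a cW gam4.
have [db db0 dbW] := continuous_distP b cW gam4.
have [dy dy0 dyW] := continuous_distP y0 cW gam4.
have [dv dv0 dvV] := continuous_distP y0 cv eta4.
pose r := Num.min (Num.min (Num.min ra rb) (Num.min da db)) (Num.min dy dv).
have r0 : 0 < r by rewrite !lt_min ra0 rb0 da0 db0 dy0 dv0.
(* Translating [a], [b] and [y0] by the same [h] preserves the combination; the values of [W] move
   by less than [gam / 4], so half of the gap remains. *)
have rP h : `|h| < r -> [/\ P (a + h), P (b + h), P (y0 + h),
    t * W (a + h) + (1 - t) * W (b + h) + gam / 2 <= W (y0 + h) &
    `|v y0 - v (y0 + h)| < eta / 4].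
  rewrite !lt_min => /andP[/andP[/andP[hra hrb] /andP[hda hdb]] /andP[hdy hdv]].
  have sub c : c - (c + h) = - h by rewrite opprD addNKr.
  have Pa : P (a + h) by apply: raP; rewrite addrC addKr.
  have Pb : P (b + h) by apply: rbP; rewrite addrC addKr.
  have y0E : y0 + h = t *: (a + h) + (1 - t) *: (b + h).
    by apply/rowP => i; rewrite /y0 !mxE; ring.
  split => //; first by rewrite y0E; exact: polytope_conv.
    have := daW (a + h); rewrite sub normrN => /(_ hda).
    have := dbW (b + h); rewrite sub normrN => /(_ hdb).
    have := dyW (y0 + h); rewrite sub normrN => /(_ hdy).
    rewrite !ltr_norml => /andP[_ hy] /andP[hb _] /andP[ha _].
    move: t01 => /andP[t0 t1]; have t1' : 0 <= 1 - t by lra.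
    have k1 : t * W (a + h) <= t * (W a + gam / 4) by rewrite ler_wpM2l//; lra.
    have k2 : (1 - t) * W (b + h) <= (1 - t) * (W b + gam / 4).
      by rewrite ler_wpM2l//; lra.
    by move: hy; rewrite /gam in k1 k2 *; lra.
  by apply: dvV; rewrite sub normrN.
(* As [v] varies by less than [eta / 4] near [y0], each [sigma] in this range lies between [- v y]
   and [- v y + eta]. *)
exists (spacetime (- v y0 + eta / 4) (y0 - const_mx (r / 2))).
exists (spacetime (- v y0 + 3 * eta / 4) (y0 + const_mx (r / 2))).
split.
  rewrite /box_volume /spacetime big_split_ord/= mulr_gt0//.
    rewrite big_ord1 !row_mxEl !mxE !mulr1n lt_max; apply/orP; right; lra.
  apply: prodr_gt0 => i _; rewrite !row_mxEr !mxE lt_max; apply/orP; right; lra.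
move=> q qbox; rewrite -(spacetimeK q).
set sigma := time q; set y := Defs.space q.
have sig : - v y0 + eta / 4 < sigma <= - v y0 + 3 * eta / 4.
  have := qbox (lshift n ord0).
  by rewrite -(spacetimeK q) /spacetime !row_mxEl !mxE !mulr1n.
have yr : `|y - y0| <= r / 2.
  rewrite [leLHS]/Num.norm/= mx_normrE; apply/bigmax_leP.
  split=> [|[i j] _]; first by rewrite divr_ge0// ltW.
  have := qbox (rshift 1 j); rewrite -(spacetimeK q) /spacetime !row_mxEr.
  rewrite /= [i]ord1 ler_norml !mxE -/y => /andP[? ?].
  by apply/andP; split; lra.
have yr' : `|y - y0| < r by lra.
have yE : y0 + (y - y0) = y by rewrite addrC subrK.
have [Pah Pbh] := rP _ yr'; rewrite yE => Py Wy vy.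
have [p pT pq] : exists2 p, slab T p &
    subdifferential (fine \o psi) p (spacetime sigma y).
  apply: (@slab_subgradient _ _ P u v _ y (r / 4)) => //.
  - by rewrite divr_gt0.
  - move=> z' zy; have [|_ _] := rP (z' - y0).
      rewrite -(subrK y z') -addrA (le_lt_trans (ler_normD _ _))//; lra.
    by rewrite addrC subrK.
  (* At time 0 the potential is at most [psi0] by Fenchel's inequality, and [x] nearly attains the
     supremum defining [u0 y]. *)
  - move=> e e0; have [x xP] := dual_potential_adherent Py e0.
    exists x; have [[y' Py' ->] _] := mf (spacetime 0 x).
    rewrite dot_moment_lift mul0r subr0.
    have := fenchel_ineq x Py'; move: xP; rewrite !uE//; lra.
  - by move: vy; rewrite ltr_norml => /andP[? ?]; lra.
  (* The maximands at the translates of [a] and [b], averaged with weights [t] and [1 - t], exceed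
     [dot x y - W y] by at least [gam / 2], which pays for [sigma]. *)
  - move=> x; have [_ mfx] := mf (spacetime T x).
    have := mfx _ Pah; have := mfx _ Pbh; rewrite !dot_moment_lift.
    have dotE : t * dot x (a + (y - y0)) + (1 - t) * dot x (b + (y - y0)) =
        dot x y.
      rewrite -!dotZr -dotDr; congr dot.
      by apply/rowP => i; rewrite /y0 !mxE; ring.
    move: t01 => /andP[t0 t1]; have t1' : 0 <= 1 - t by lra.
    set F := (fine \o psi) _.
    move=> /(ler_wpM2l t1') hb /(ler_wpM2l t0) ha.
    have sT : sigma * T <= (- v y + eta) * T.
      rewrite ler_pM2r//; move: vy; rewrite ltr_norml => /andP[? ?]; lra.
    rewrite mulrDl etaT in sT; rewrite /W in Wy; lra.
by exists p.
Qed.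

End toric.

Theorem theorem1 (R : realType) (n d : nat)
    (nu : 'I_d -> 'rV[int]_n) (lam : 'I_d -> R)
    (psi0 dpsi0 du0 : 'rV[R]_n -> R) (n_gt0 : (0 < n)%N)
    (data : toric_cauchy_data nu lam psi0 dpsi0 du0) :
  let u0 := dual_potential psi0 in
  let psi := legendre_potential (polytope nu lam) u0 du0 in
  let MA := monge_ampere (fine \o psi) in
  let Tspan := convex_lifespan psi0 dpsi0 in
  [/\ monge_ampere_zero_on (fine \o psi) (regular_locus psi),
      [set p | 0 <= time p /\ ((time p)%:E < Tspan)%E]
        `<=` regular_locus psi &
      forall T : R, (Tspan < T%:E)%E ->
        [/\ ~ solves_cauchy T psi0 dpsi0 (fine \o psi),
            (0 < MA (singular_locus psi `&` slab T))%E &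
            MA (slab T) = MA (singular_locus psi `&` slab T)]].
Proof.
move=> u0 psi MA Tspan.
have [u cu uE] := dual_potential_continuous data.
have [v cv vE] := du0_continuous data.
have cP := polytope_compact data.
have [z Pz] := delzant_full (tcd_delzant data).
have P0 : polytope nu lam !=set0 by exists z; exact: interior_subset.
have [_ mf] := max_affine_legendre cP P0 cu cv uE vE.
pose N : set 'rV[R]_(1 + n) := moment_lift v @` polytope nu lam.
have N0 : box_null N.
  apply: (graph_box_null (f := fun y => - v y) cP) => y.
  exact: (continuousN (cv y)).
have regN p : regular_locus psi p -> subdifferential (fine \o psi) p `<=` N.
  by case=> _ _ df; exact: (subdifferential_max_affine_differentiable mf df).
split.
- move=> E _ Ereg; apply: (lebesgue_rV_null _ N0) => //.
  by move=> q [p Ep pq]; exact: regN (Ereg _ Ep) _ pq.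
- by move=> p [p0 pT]; exact: (regular_before_lifespan data).
move=> T TT.
(* Subgradients at regular points lie in the null set [N], so only those at singular points
   count. *)
have slabE : MA (slab T) = MA (singular_locus psi `&` slab T).
  apply/eqP; rewrite eq_le; apply/andP; split; last first.
    by apply: le_lebesgue_rV => q [p [_ pT] pq]; exists p.
  apply: (lebesgue_rV_setU_null N0) => q [p pT pq].
  have [reg|sing] := pselect (regular_locus psi p).
    by right; exact: regN reg _ pq.
  by left; exists p => //; split => //; split => //; case/andP: pT.
have slab_gt0 : (0 < MA (slab T))%E.
  have [a [b [vol_gt0 sub]]] := slab_subdifferential_box data TT.
  apply: (@lt_le_trans _ _ (box_volume a b)%:E); first by rewrite lte_fin.
  exact: le_trans (lebesgue_rV_box_ge a b) (le_lebesgue_rV sub).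
split => //; last by rewrite -slabE.
move=> [MA0 _ _]; move: slab_gt0.
by rewrite /MA MA0 ?ltxx//; exact: slab_borel.
Qed.
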